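(* Let $N,\chi,k$ be as in the context and let $\epsilon=(\epsilon_p)_{p\mid N}$ be any sign vector. For each integer $n$ let $f_n$ denote the reduced modular form of order $n$ in $A^\epsilon(N,k,\chi)$, if it exists, and for each integer $m$ let $A^\epsilon_m(N,k,\chi)$ be the subspace of forms $f\in A^\epsilon(N,k,\chi)$ with $f=\sum_{n\ge m}a(n)q^n$. Then for any integer $m$ the set $\{f_n: n\ge m,\ f_n\text{ exists}\}$ is a basis for $A_m^\epsilon(N,k,\chi)$. In particular, the spaces $A^\epsilon(N,k,\chi)$, $M^\epsilon(N,k,\chi)$ and $S^\epsilon(N,k,\chi)$ have (canonical) bases consisting of reduced modular forms.
   Context: $N>1$ is an integer whose odd part is squarefree and whose $2$-part is $1$ or $4$. For odd primes $p\mid N$, $\chi_p=\left(\frac{\cdot}{p}\right)$; if $4\,\|\,N$, $\chi_2=\left(\frac{-4}{\cdot}\right)$; $\chi=\prod_{p\mid N}\chi_p$. $k$ is an integer with $\chi(-1)=(-1)^k$. $A(N,k,\chi)$, $M(N,k,\chi)$, $S(N,k,\chi)$ are the spaces of weakly holomorphic modular forms (holomorphic on the upper half plane, meromorphic at all cusps), holomorphic modular forms, and cusp forms of weight $k$, level $\Gamma_0(N)$ and character $\chi$; $q=e^{2\pi i\tau}$. A sign vector is $\epsilon=(\epsilon_p)_{p\mid N}$ (indexed by primes $p\mid N$) with $\epsilon_p\in\{\pm1\}$. $A^\epsilon(N,k,\chi)$ is the subspace of $f=\sum a(n)q^n\in A(N,k,\chi)$ with $a(n)=0$ whenever $\chi_p(n)=-\epsilon_p$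 for some $p\mid N$; $M^\epsilon=M\cap A^\epsilon$, $S^\epsilon=S\cap A^\epsilon$. $s(n)=2^{\omega(\gcd(n,N))}$, where $\omega$ counts distinct prime divisors and $\gcd(0,N)=N$. A form $f=\sum_na(n)q^n\in A^\epsilon(N,k,\chi)$ is called reduced of order $m$ if $f=\frac1{s(m)}q^m+O(q^{m+1})$ and for each $n>m$ with $a(n)\ne0$ there is no $g\in A^\epsilon(N,k,\chi)$ with $g=q^n+O(q^{n+1})$. There is at most one reduced form of each order. *)

(* Defs.v *)
From HB Require Import structures.
From mathcomp Require Import all_boot all_order all_algebra.
From mathcomp Require Import all_classical all_reals all_analysis.
From mathcomp Require Import complex.
From mathcomp Require Import ring.

Set Implicit Arguments.
Unset Strict Implicit.
Unset Printing Implicit Defensive.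

Import Order.TTheory GRing.Theory Num.Theory.
Import numFieldNormedType.Exports.

Local Open Scope classical_set_scope.
Local Open Scope ring_scope.

Definition squarefree (n : nat) : Prop :=
  forall d : nat, (d ^ 2 %| n)%N -> d = 1%N.

Definition legendre (p : nat) (n : int) : int :=
  if (p%:Z %| n)%Z then 0
  else if [exists x : 'I_p, ((x%:Z) ^+ 2 == n %[mod p%:Z])%Z] then 1 else -1.

(* The Kronecker symbol (-4 / n). *)
Definition kronecker_m4 (n : int) : int :=
  if (n == 1 %[mod 4])%Z then 1 else if (n == 3 %[mod 4])%Z then -1 else 0.

Definition chi_prime (p : nat) : int -> int :=
  if p == 2%N then kronecker_m4 else legendre p.

Definition chi (N : nat) (n : int) : int :=
  \prod_(p <- primes N) chi_prime p n.

Definition s_mult (N : nat) (n : int) : nat :=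
  (2 ^ size (primes (gcdn `|n| N)))%N.

Section LinearAlgebra.
Variables (K : fieldType) (V : lmodType K).

Definition lin_independent (B : set V) : Prop :=
  forall (n : nat) (v : 'I_n -> V) (c : 'I_n -> K),
    injective v -> (forall i, B (v i)) ->
    \sum_(i < n) c i *: v i = 0 -> forall i, c i = 0.

Definition lin_span (B : set V) : set V :=
  [set w | exists (n : nat) (v : 'I_n -> V) (c : 'I_n -> K),
     (forall i, B (v i)) /\ w = \sum_(i < n) c i *: v i].

Definition is_basis (B W : set V) : Prop :=
  lin_independent B /\ lin_span B = W.

End LinearAlgebra.

Section ModularForms.
Variable R : realType.

Definition upper_half_plane : Type := {z : R[i] | 0 < complex.Im z}.

Definition SL2Z : Type := {g : 'M[int]_2 | \det g == 1}.

Definition mx (g : SL2Z) : 'M[int]_2 := val g.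

Definition in_Gamma0 (N : nat) (g : SL2Z) : bool :=
  (N%:Z %| mx g 1%R 0%R)%Z.

Definition denom (g : SL2Z) (z : R[i]) : R[i] :=
  (mx g 1 0)%:~R * z + (mx g 1 1)%:~R.

Definition moebius_fun (g : SL2Z) (z : R[i]) : R[i] :=
  ((mx g 0 0)%:~R * z
    + (mx g 0 1)%:~R) / denom g z.

Lemma moebius_subproof (g : SL2Z) (t : upper_half_plane) :
  0 < complex.Im (moebius_fun g (val t)).
Proof.
have := valP g; rewrite -/(mx g) /= (expand_det_row _ 0) !big_ord_recl big_ord0.
rewrite /cofactor !det_mx11 !mxE /=.
have -> : lift 0 (0 : 'I_1) = 1 :> 'I_2 by exact/val_inj.
have -> : lift 1 (0 : 'I_1) = 0 :> 'I_2 by exact/val_inj.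
rewrite addr0 addn0 /bump /= expr0 expr1 mul1r mulN1r mulrN => /eqP.
case: t => -[x y] /=; rewrite /moebius_fun /denom => y_gt0.
move: (mx g 0 0) (mx g 0 1) (mx g 1 0) (mx g 1 1) => a b c d.
have intC (n : int) : n%:~R = (n%:~R : R)%:C%C :> R[i] by rewrite rmorph_int.
rewrite !intC => /(congr1 (fun n : int => n%:~R : R)).
rewrite rmorphB !rmorphM /=.
move: (a%:~R : R) (b%:~R : R) (c%:~R : R) (d%:~R : R).
move=> {intC} {}a {}b {}c {}d /= det1; simpc.
set D := _ + (c * y) ^+ 2.
have D_gt0 : 0 < D.
  rewrite lt0r addr_ge0 ?sqr_ge0 // andbT paddr_eq0 ?sqr_ge0 // !sqrf_eq0.
  rewrite mulf_eq0 (gt_eqF y_gt0) orbF; apply/negP => /andP[/eqP cxd /eqP c0].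
  move: cxd det1; rewrite c0 mul0r add0r => ->; rewrite !mulr0 subrr => /eqP.
  by rewrite eq_sym oner_eq0.
have -> : - ((a * x + b) * (c * y / D)) + a * y * ((c * x + d) / D)
    = (a * d - b * c) * y / D by ring.
by rewrite det1 mul1r divr_gt0.
Qed.

Definition moebius (g : SL2Z) (t : upper_half_plane) : upper_half_plane :=
  exist _ (moebius_fun g (val t)) (moebius_subproof g t).

Definition slash (k : int) (f : upper_half_plane -> R[i]) (g : SL2Z) :
    upper_half_plane -> R[i] :=
  fun t => denom g (val t) ^ (- k) * f (moebius g t).

Definition extend0 (f : upper_half_plane -> R[i]) (z : R[i]) : R[i] :=
  if insub z is Some t then f t else 0.

(* [derivable] over the field R[i] is complex differentiability; the upper half
   plane is open, so the values of the extension outside it are irrelevant. *)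
Definition holomorphic (f : upper_half_plane -> R[i]) : Prop :=
  forall t : upper_half_plane,
    derivable (extend0 f : R[i]^o -> R[i]^o) (val t) 1.

Definition cexp (z : R[i]) : R[i] :=
  (expR (complex.Re z))%:C%C *
  (cos (complex.Im z) +i* sin (complex.Im z))%C.

(* q_h^n with q_h = exp(2 pi i tau / h); q is the case h = 1. *)
Definition qpow (h : nat) (n : int) (t : upper_half_plane) : R[i] :=
  cexp (2 * (pi : R)%:C%C * 'i%C * n%:~R * val t / h%:R).

(* f = sum_n a(n) q_h^n on the upper half plane, with a(n) = 0 for n << 0. *)
Definition qexpansion (h : nat) (f : upper_half_plane -> R[i])
    (a : int -> R[i]) : Prop :=
  exists n0 : int, (forall n, n < n0 -> a n = 0) /\
    forall t : upper_half_plane,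
      series (fun j : nat => a (n0 + j%:Z) * qpow h (n0 + j%:Z) t : R[i]^o) @ \oo
        --> (f t : R[i]^o).

(* For a Dirichlet character psi modulo N, all the slashes f|g are invariant
   under tau |-> tau + N when f is modular, so the cusps can be tested with
   expansions in q_N. *)
Definition weakly_holomorphic_forms (N : nat) (k : int) (psi : int -> int) :
    set (upper_half_plane -> R[i]) :=
  [set f | [/\ holomorphic f,
    forall g : SL2Z, in_Gamma0 N g ->
      slash k f g = (psi (mx g 1 1))%:~R *: f &
    forall g : SL2Z, exists a, qexpansion N (slash k f g) a]].

Definition modular_forms (N : nat) (k : int) (psi : int -> int) :
    set (upper_half_plane -> R[i]) :=
  [set f | weakly_holomorphic_forms N k psi f /\
    forall g : SL2Z, exists a, qexpansion N (slash k f g) a /\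
      forall n, n < 0 -> a n = 0].

Definition cusp_forms (N : nat) (k : int) (psi : int -> int) :
    set (upper_half_plane -> R[i]) :=
  [set f | weakly_holomorphic_forms N k psi f /\
    forall g : SL2Z, exists a, qexpansion N (slash k f g) a /\
      forall n, n <= 0 -> a n = 0].

Definition Aeps (N : nat) (k : int) (eps : nat -> int) :
    set (upper_half_plane -> R[i]) :=
  [set f | weakly_holomorphic_forms N k (chi N) f /\
    exists a, qexpansion 1 f a /\
      forall (n : int) (p : nat), p \in primes N ->
        chi_prime p n = - eps p -> a n = 0].

Definition Meps (N : nat) (k : int) (eps : nat -> int) :
    set (upper_half_plane -> R[i]) :=
  modular_forms N k (chi N) `&` Aeps N k eps.

Definition Seps (N : nat) (k : int) (eps : nat -> int) :
    set (upper_half_plane -> R[i]) :=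
  cusp_forms N k (chi N) `&` Aeps N k eps.

Definition Aeps_from (N : nat) (k : int) (eps : nat -> int) (m : int) :
    set (upper_half_plane -> R[i]) :=
  [set f | Aeps N k eps f /\
    exists a, qexpansion 1 f a /\ forall n, n < m -> a n = 0].

(* f = c q^m + O(q^(m+1)) *)
Definition leading_term (f : upper_half_plane -> R[i]) (c : R[i]) (m : int) :
    Prop :=
  exists a, [/\ qexpansion 1 f a, forall n, n < m -> a n = 0 & a m = c].

Definition reduced (N : nat) (k : int) (eps : nat -> int) (m : int)
    (f : upper_half_plane -> R[i]) : Prop :=
  [/\ Aeps N k eps f, leading_term f ((s_mult N m)%:R^-1) m &
    exists a, qexpansion 1 f a /\
      forall n, m < n -> a n != 0 ->
        ~ exists g, Aeps N k eps g /\ leading_term g 1 n].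

End ModularForms.

(* Main.v *)
Require Import Defs.
From mathcomp Require Import all_boot all_order all_algebra.
From mathcomp Require Import all_classical all_reals all_analysis.
From mathcomp Require Import complex.
From mathcomp Require Import ring lra zify.

Set Implicit Arguments.
Unset Strict Implicit.
Unset Printing Implicit Defensive.

Import Order.TTheory GRing.Theory Num.Theory.
Import numFieldNormedType.Exports.
Import Normc.

Local Open Scope classical_set_scope.
Local Open Scope ring_scope.

(** Linear algebra reduces the statement to two facts about [A^eps]: the orders
    at infinity of its nonzero forms are bounded above, and a form in it which
    is holomorphic (vanishes) at infinity is so at every cusp.

    Both come from the scaled form [v(z) = f(z / N)]. Up to sign, [v|g] for [g]
    in SL2(Z) depends only on the top row [(a : b)] of [g] in P^1(Z/N), and
    [v|g] is a translate of [v] when [a] is prime to [N]. For every [p | N] a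
    whole residue class of coefficients modulo the [p]-part [Q] of [N] vanishes,
    i.e. [sum_(j < Q) e(- j n0 / Q) v|T^(j N / Q) = 0]. Acting by [g] with
    [p | a] on this relation expresses [v|g] through forms [v|g'] whose [a'] is
    divisible by fewer primes of [N]. Hence every [v|g] is bounded on a
    horizontal line by a fixed multiple of the supremum of [|v|] on that line.

    The behaviour of [f] at infinity thus controls its behaviour at all cusps.
    Moreover a bound for [v] on [Im z = 1/2] bounds its coefficients, hence
    bounds [v] on [Im z >= 1], with a small factor if [v] has large order; since
    [z |-> -1/z] maps the segment [|Re z| <= 1/2], [Im z = 1/2] into [Im z >= 1],
    a form of large order vanishes. *)

(** * Exponentials and norms of complex numbers *)

Section Cx.
Variable R : realType.
Implicit Types (z w : R[i]) (h n : nat).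

Lemma normc_norm z : `|z| = (normc z)%:C%C.
Proof. by rewrite normc_def; case: z. Qed.

Lemma normc_ge0 z : 0 <= normc z.
Proof. by case: z => x y; exact: sqrtr_ge0. Qed.

Lemma normc_sum (I : Type) (r : seq I) (P : pred I) (F : I -> R[i]) :
  normc (\sum_(i <- r | P i) F i) <= \sum_(i <- r | P i) normc (F i).
Proof.
elim/big_ind2: _ => [|x a y b xa yb|i _]; rewrite ?normc0 ?lexx //.
by apply: le_trans (le_normcD _ _) _; apply: lerD.
Qed.

Lemma normcB z w : normc (z - w) <= normc z + normc w.
Proof. by rewrite -[normc w]normcN; exact: le_normcD. Qed.

Lemma normc_int (m : int) : normc (m%:~R : R[i]) = `|m%:~R|.
Proof.
have -> : m%:~R = (m%:~R : R)%:C%C :> R[i] by rewrite rmorph_int.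
by rewrite /normc /= expr0n /= addr0 sqrtr_sqr.
Qed.

Lemma normc_nat (m : nat) : normc (m%:R : R[i]) = m%:R.
Proof. by have := normc_int m; rewrite -!pmulrn ger0_norm ?ler0n. Qed.

Lemma normc_exprz z (k : int) : normc (z ^ k) = normc z ^ k.
Proof.
have normX (m : nat) : normc (z ^+ m) = normc z ^+ m.
  elim: m => [|m IH]; first by rewrite !expr0 normc1.
  by rewrite !exprS normcM IH.
by case: k => m; rewrite ?NegzE -?exprnP -?exprnN ?normcV normX.
Qed.

Lemma cexpD z w : cexp (z + w) = cexp z * cexp w.
Proof.
case: z w => [a b] [c d]; rewrite /cexp /= expRD cosD sinD.
by apply/eqP; rewrite eq_complex /=; apply/andP; split; apply/eqP; ring.
Qed.

Lemma normc_cexp z : normc (cexp z) = expR (complex.Re z).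
Proof.
case: z => a b; rewrite /cexp normcM /= expr0n /= addr0 sqrtr_sqr cos2Dsin2.
by rewrite sqrtr1 mulr1 ger0_norm ?expR_ge0.
Qed.

Lemma cexp0 : cexp (0 : R[i]) = 1.
Proof.
by rewrite /cexp /= expR0 cos0 sin0 mul1r.
Qed.

Lemma cexp_neq0 z : cexp z != 0.
Proof.
apply/negP => /eqP e0; have := normc_cexp z; rewrite e0 normc0 => /esym/eqP.
by rewrite gt_eqF ?expR_gt0.
Qed.

(** Same formula as [qpow], but for arbitrary complex arguments: at argument 1 it gives roots of
    unity, used as weights in finite Fourier sums. *)
Definition qc (h : nat) (n : int) z : R[i] :=
  cexp (2 * (pi : R)%:C%C * 'i%C * n%:~R * z / h%:R).

Lemma qcE h (n : int) z :
  qc h n z = cexp ((2 * pi / h%:R * n%:~R : R)%:C%C * ('i%C * z)).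
Proof.
rewrite /qc; congr cexp.
by rewrite !rmorphM fmorphV !rmorph_nat rmorph_int; ring.
Qed.

Lemma qcDr h (n : int) z w : qc h n (z + w) = qc h n z * qc h n w.
Proof. by rewrite /qc mulrDr mulrDl cexpD. Qed.

Lemma qcDl h (m n : int) z : qc h (m + n) z = qc h m z * qc h n z.
Proof. by rewrite /qc intrD mulrDr !mulrDl cexpD. Qed.

Lemma qc0 h z : qc h 0 z = 1.
Proof. by rewrite /qc mulr0 !mul0r cexp0. Qed.

Lemma normc_qc h (n : int) z :
  normc (qc h n z) = expR (- (2 * pi / h%:R * n%:~R * complex.Im z)).
Proof.
by rewrite qcE normc_cexp; congr expR; case: z => x y /=; ring.
Qed.

Lemma qc_period h (m : int) : (0 < h)%N -> qc h (h%:Z * m) (1 : R[i]) = 1.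
Proof.
move=> h0; suff nat_case (j : nat) : qc h (h%:Z * j%:Z) (1 : R[i]) = 1.
  case: m => j; first exact: nat_case.
  apply: (mulIf (cexp_neq0 (2 * (pi : R)%:C%C * 'i%C * (h%:Z * j.+1%:Z)%:~R * 1 / h%:R))).
  rewrite -[cexp _]/(qc h (h%:Z * j.+1%:Z) 1) -qcDl NegzE mulrN addNr qc0.
  by rewrite nat_case mulr1.
elim: j => [|j IH]; first by rewrite mulr0 qc0.
rewrite intS mulrDr qcDl IH !mulr1 /qc mulr1 mulfK ?pnatr_eq0 -?lt0n //.
have -> : 2 * (pi : R)%:C%C * 'i%C = (0 +i* (pi *+ 2))%C.
  have -> : 2 * (pi : R)%:C%C = (2 * pi : R)%:C%C by rewrite rmorphM rmorph_nat.
  by apply/eqP; rewrite eq_complex /=; apply/andP; split; apply/eqP; ring.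
by rewrite /cexp /= expR0 cos2pi sin2pi mul1r.
Qed.

(** With theta = pi n / h in (0, pi), the real part is cos(2 theta) = 1 - 2 sin(theta)^2, which is
    less than 1 because sin(theta) > 0. *)
Lemma qc1_neq1 h (n : nat) : (0 < n < h)%N -> qc h n%:Z (1 : R[i]) != 1.
Proof.
move=> /andP[n0 nh]; apply/negP => /eqP.
have h0 : (0 : R) < h%:R by rewrite ltr0n (leq_ltn_trans (leq0n n) nh).
have -> : qc h n%:Z (1 : R[i]) = cexp (0 +i* ((pi * n%:R / h%:R) *+ 2))%C.
  rewrite qcE -pmulrn; congr cexp.
  by apply/eqP; rewrite eq_complex /=; apply/andP; split; apply/eqP; ring.
rewrite /cexp /= expR0 mul1r => -[c1 _]; move: c1.
rewrite cos_mulr2n cos2sin2 => c1.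
have: 0 < sin (pi * n%:R / h%:R : R).
  apply: sin_gt0_pi; rewrite divr_gt0 ?mulr_gt0 ?pi_gt0 ?h0 ?ltr0n //=.
  by rewrite ltr_pdivrMr // ltr_pM2l ?pi_gt0 // ltr_nat.
set s := sin _ in c1 *; move=> s0.
have := mulr_gt0 s0 s0; lra.
Qed.

(** Orthogonality of additive characters: when [h] does not divide [n], the sum is geometric with
    ratio [x != 1] and [x ^+ h = 1]. *)
Lemma sum_qc h (n : int) : (0 < h)%N ->
  \sum_(j < h) qc h (n * j%:Z) (1 : R[i]) = if (h%:Z %| n)%Z then h%:R else 0.
Proof.
move=> h0; case: ifPn => [/dvdzP[m ->]|hn].
  under eq_bigr => j _ do rewrite [_ * h%:Z]mulrC -mulrA qc_period //.
  by rewrite sumr_const card_ord.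
have hZ0 : h%:Z != 0 by rewrite eqz_nat -lt0n.
set x := qc h n (1 : R[i]).
have xn j : qc h (n * j%:Z) (1 : R[i]) = x ^+ j.
  elim: j => [|j IH]; first by rewrite mulr0 qc0.
  by rewrite intS mulrDr qcDl IH mulr1 exprS.
under eq_bigr => j _ do rewrite xn.
have x1 : x != 1.
  rewrite /x (divz_eq n h%:Z) qcDl mulrC [_ * h%:Z]mulrC qc_period // mulr1.
  have := modz_ge0 n hZ0; have := ltz_pmod n (d := h%:Z) h0.
  have : (n %% h%:Z)%Z != 0 by apply: contra hn => /eqP/dvdz_mod0P.
  case: (n %% h%:Z)%Z => // r; rewrite eqz_nat ltz_nat => r0 rh _.
  by rewrite qc1_neq1 // lt0n r0.
apply: (mulfI (x := x - 1)); first by rewrite subr_eq0.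
by rewrite mulr0 -subrX1 -xn mulrC qc_period ?subrr.
Qed.

End Cx.

(** * Expansions in powers of q *)

Lemma int_le_natP (m n : int) : m <= n -> exists d : nat, n = m + d%:Z.
Proof. by rewrite -subr_ge0 => /gez0_abs E; exists `|n - m|%N; rewrite E subrKC. Qed.

Section QExpansion.
Variable R : realType.
Local Notation H := (upper_half_plane R).
Implicit Types (h i j : nat) (f g : H -> R[i]) (a b : int -> R[i]) (t : H).

Definition psum h a (m : int) J t : R[i] :=
  \sum_(0 <= j < J) a (m + j%:Z) * qpow h (m + j%:Z) t.

Lemma psum_shift h a (m : int) d J t : (forall n : int, n < m + d%:Z -> a n = 0) ->
  psum h a m (d + J) t = psum h a (m + d%:Z) J t.
Proof.
move=> a0; rewrite /psum (big_cat_nat (n := d)) ?leq_addr ?addr0 //=.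
rewrite big_nat_cond big1 ?add0r => [|i /andP[/andP[_ id] _]]; last first.
  by rewrite a0 ?mul0r // ltrD2l ltz_nat.
rewrite -{1}[d]add0n big_addn addKn.
by apply: eq_bigr => i _; rewrite PoszD addrA (addrAC m).
Qed.

(** The starting index hidden in [qexpansion] may be traded for any [m] below which the coefficients
    vanish: the partial sums only change in length. *)
Lemma qexpansion_lim h f a (m : int) : (forall n, n < m -> a n = 0) ->
  qexpansion h f a -> forall t (e : R), 0 < e ->
  exists J0, forall J, (J0 <= J)%N -> normc (f t - psum h a m J t) < e.
Proof.
move=> am0 [m1 [am1 lim]] t e e0.
have eC : 0 < e%:C%C :> R[i] by rewrite ltcR.
have /cvgrPdist_lt/(_ _ eC)[J0 _ HJ0] := lim t.
have {}HJ0 J : (J0 <= J)%N -> normc (f t - psum h a m1 J t) < e.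
  by move=> /HJ0 /=; rewrite normc_norm ltcR.
have [mm1|/ltW m1m] := leP m m1.
  have [d dE] := int_le_natP mm1.
  exists (d + J0)%N => J dJ.
  have -> : psum h a m J t = psum h a m1 (J - d) t.
    by rewrite dE -psum_shift -?dE // subnKC // (leq_trans _ dJ) ?leq_addr.
  by apply: HJ0; rewrite leq_subRL // (leq_trans _ dJ) ?leq_addr.
have [d dE] := int_le_natP m1m.
exists J0 => J J0J.
have -> : psum h a m J t = psum h a m1 (d + J) t by rewrite psum_shift -?dE.
by apply: HJ0; rewrite (leq_trans J0J) ?leq_addl.
Qed.

Lemma lim_qexpansion h f a (m : int) : (forall n, n < m -> a n = 0) ->
  (forall t (e : R), 0 < e ->
    exists J0, forall J, (J0 <= J)%N -> normc (f t - psum h a m J t) < e) ->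
  qexpansion h f a.
Proof.
move=> am lim; exists m; split=> // t; apply/cvgrPdist_lt => eps eps0.
have [e e0 ->] : exists2 e : R, 0 < e & eps = e%:C%C.
  by case: eps eps0 => x y; rewrite ltcE /= => /andP[/eqP -> x0]; exists x.
have [J0 HJ0] := lim t e e0.
by exists J0 => // J /HJ0; rewrite /= normc_norm ltcR.
Qed.

Lemma qexpansion_linear h f g a b (c : R[i]) :
  qexpansion h f a -> qexpansion h g b ->
  qexpansion h (fun t => c * f t + g t) (fun n => c * a n + b n).
Proof.
move=> fa gb; have [m1 [am1 _]] := fa; have [m2 [bm2 _]] := gb.
pose m := Order.min m1 m2.
have am n : n < m -> a n = 0 by rewrite lt_min => /andP[/am1].
have bm n : n < m -> b n = 0 by rewrite lt_min => /andP[_ /bm2].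
apply: (@lim_qexpansion _ _ _ m) => [n nm|t e e0].
  by rewrite am // bm // mulr0 addr0.
have c1 : 0 < normc c + 1 by rewrite ltr_wpDl ?normc_ge0.
have e1 : 0 < e / 2 / (normc c + 1) by rewrite !divr_gt0.
have e2 : 0 < e / 2 by rewrite divr_gt0.
have [J1 HJ1] := qexpansion_lim am fa t e1.
have [J2 HJ2] := qexpansion_lim bm gb t e2.
exists (maxn J1 J2) => J; rewrite geq_max => /andP[/HJ1 {}HJ1 /HJ2 {}HJ2].
have -> : psum h (fun n => c * a n + b n) m J t = c * psum h a m J t + psum h b m J t.
  rewrite /psum mulr_sumr -big_split /=.
  by apply: eq_bigr => i _; rewrite mulrDl mulrA.
have -> : c * f t + g t - (c * psum h a m J t + psum h b m J t) =
  c * (f t - psum h a m J t) + (g t - psum h b m J t) by ring.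
apply: le_lt_trans (le_normcD _ _) _; rewrite [e]splitr ler_ltD // normcM.
rewrite ltr_pdivlMr // in HJ1.
apply: le_trans (ltW HJ1); rewrite mulrC ler_wpM2l ?normc_ge0 //.
by rewrite lerDl.
Qed.

Lemma normc_qpow h (n : int) t :
  normc (qpow h n t) = expR (- (2 * pi / h%:R * n%:~R * complex.Im (val t))).
Proof. exact: normc_qc. Qed.

Definition Hpt (x y : R) (y0 : 0 < y) : H := exist _ (x +i* y)%C y0.

(** Terms of a series convergent at [t] are bounded: from [J0] on each is a difference of two
    remainders of norm below 1, whence the 2, and the earlier ones are covered by their sum. *)
Lemma coef_bound h f a t : qexpansion h f a -> exists2 C : R, 0 <= C &
  forall n : int, normc (a n) <= C * expR (2 * pi / h%:R * n%:~R * complex.Im (val t)).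
Proof.
move=> fa; have [m [am _]] := fa.
pose T j := a (m + j%:Z) * qpow h (m + j%:Z) t.
have [J0 HJ0] := qexpansion_lim am fa t (ltr01 : (0 : R) < 1).
have S0 : 0 <= \sum_(0 <= j < J0) normc (T j) by apply: sumr_ge0 => i _; exact: normc_ge0.
exists (2 + \sum_(0 <= j < J0) normc (T j)); first by rewrite addr_ge0.
move=> n; have [nm|mn] := ltP n m.
  by rewrite am // normc0 mulr_ge0 ?expR_ge0 // addr_ge0.
have [j ->] := int_le_natP mn.
suff : normc (T j) <= 2 + \sum_(0 <= j < J0) normc (T j).
  by rewrite normcM normc_qpow expRN ler_pdivrMr ?expR_gt0 //; apply.
have [J0j|jJ0] := leqP J0 j.
  have -> : T j = (f t - psum h a m j t) - (f t - psum h a m j.+1 t).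
    by rewrite /psum big_nat_recr //= -/(T j); ring.
  apply: le_trans (normcB _ _) _; apply: ler_wpDr => //.
  by apply: ltW; rewrite -[2]/(1 + 1) ltrD ?HJ0 // leqW.
apply: (@le_trans _ _ (\sum_(0 <= j < J0) normc (T j))); last by rewrite lerDr.
rewrite big_mkord.
rewrite (bigD1 (Ordinal jJ0)) //= lerDl; apply: sumr_ge0 => i _.
exact: normc_ge0.
Qed.

Section Tail.
Variables (h : nat) (h0 : (0 < h)%N).
Local Notation c := (2 * pi / h%:R : R).

Let c_gt0 : 0 < c.
Proof. by rewrite divr_gt0 ?mulr_gt0 ?pi_gt0 ?ltr0n. Qed.

Lemma expRN_lt1 (y : R) : 0 < y -> expR (- (c * y)) < 1.
Proof. by move=> y0; rewrite expR_lt1 oppr_lt0 mulr_gt0. Qed.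

(** Coefficient growth measured at height [y1] is beaten at any larger height by a geometric series
    of ratio [r]. *)
Lemma tail_bound f a (m : int) (C y1 : R) t J :
  (forall n, n < m -> a n = 0) -> qexpansion h f a -> 0 <= C ->
  (forall n : int, normc (a n) <= C * expR (c * n%:~R * y1)) ->
  y1 < complex.Im (val t) ->
  normc (f t - psum h a m J t) <=
    C * expR (- (c * m%:~R * (complex.Im (val t) - y1))) *
    expR (- (c * (complex.Im (val t) - y1))) ^+ J /
    (1 - expR (- (c * (complex.Im (val t) - y1)))).
Proof.
move=> am fa C0 aC; set y := complex.Im _ => y1y.
have y0 : 0 < y - y1 by rewrite subr_gt0.
have := expRN_lt1 y0; set r := expR (- (c * (y - y1))) => r1.
set D := C * _.
have r0 : 0 < r by exact: expR_gt0.
have r10 : 0 < 1 - r by rewrite subr_gt0.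
have T j : normc (a (m + j%:Z) * qpow h (m + j%:Z) t) <= D * r ^+ j.
  rewrite normcM normc_qpow -/y /D /r -expRM_natl -(mulrA C) -expRD.
  apply: le_trans (ler_wpM2r (expR_ge0 _) (aC _)) _.
  rewrite -(mulrA C) -expRD ler_wpM2l // ler_expR intrD -pmulrn.
  by rewrite le_eqVlt; apply/orP; left; apply/eqP; ring.
have S i : normc (psum h a m (J + i) t - psum h a m J t) <=
    D * r ^+ J / (1 - r) * (1 - r ^+ i).
  elim: i => [|i IH]; first by rewrite addn0 !subrr normc0 mulr0.
  rewrite addnS /psum big_nat_recr //= -addrA addrCA addrC.
  apply: le_trans (le_normcD _ _) _; apply: le_trans (lerD IH (T _)) _.
  rewrite le_eqVlt exprD exprSr; apply/orP; left; apply/eqP; field.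
  by rewrite gt_eqF.
apply/ler_addgt0Pr => e e0.
have [J0 HJ0] := qexpansion_lim am fa t e0.
have -> : f t - psum h a m J t = (psum h a m (J + J0) t - psum h a m J t) +
  (f t - psum h a m (J + J0) t) by ring.
apply: le_trans (le_normcD _ _) _; apply: lerD; last by rewrite ltW // HJ0 ?leq_addl.
apply: le_trans (S J0) _; rewrite -{2}[_ / (1 - r)]mulr1 ler_wpM2l //.
  by rewrite divr_ge0 ?mulr_ge0 ?exprn_ge0 ?expR_ge0 // ltW.
by rewrite gerBl exprn_ge0 // ltW.
Qed.

Lemma growth_bound f a (m : int) (C y1 : R) t :
  (forall n, n < m -> a n = 0) -> qexpansion h f a -> 0 <= C ->
  (forall n : int, normc (a n) <= C * expR (c * n%:~R * y1)) ->
  y1 < complex.Im (val t) ->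
  normc (f t) <= C * expR (- (c * m%:~R * (complex.Im (val t) - y1))) /
    (1 - expR (- (c * (complex.Im (val t) - y1)))).
Proof.
move=> am fa C0 aC y1y; have := tail_bound 0 am fa C0 aC y1y.
by rewrite /psum big_geq // subr0 expr0 mulr1.
Qed.

Lemma exprn_small (r D e : R) (i : nat) : 0 <= r < 1 -> 0 < e ->
  exists2 J, (i < J)%N & D * r ^+ J <= e.
Proof.
move=> /andP[r0 r1] e0.
have D1 : 0 < `|D| + 1 by rewrite ltr_wpDl.
have /cvgrPdist_lt/(_ _ (divr_gt0 e0 D1))[J0 _ HJ0] : (fun J => r ^+ J) @ \oo --> (0 : R).
  by apply: cvg_expr; rewrite ger0_norm.
exists (maxn J0 i.+1); first by rewrite leq_maxr.
have := HJ0 (maxn J0 i.+1) (leq_maxl _ _); rewrite /= sub0r normrN normrX ger0_norm //.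
rewrite ltr_pdivlMr // => /ltW; apply: le_trans.
rewrite mulrC ler_wpM2l ?exprn_ge0 //; apply: le_trans (ler_norm _) _.
by rewrite lerDl.
Qed.

(* Averaging the partial sum of length [J] over [J] equidistant points of a
   period isolates one coefficient exactly. *)
Lemma cauchy_bound f a (B y : R) : qexpansion h f a -> 0 < y ->
  (forall t, complex.Im (val t) = y -> normc (f t) <= B) ->
  forall n : int, normc (a n) <= B * expR (c * n%:~R * y).
Proof.
move=> fa y0 fB n; have [m [am _]] := fa.
have B0 : 0 <= B by apply: le_trans (fB (Hpt 0 y0) erefl); exact: normc_ge0.
have [nm|mn] := ltP n m; first by rewrite am // normc0 mulr_ge0 ?expR_ge0.
have [i ni] := int_le_natP mn.
(* Coefficients bounded at height [y / 2] give remainders on the line of height [y] that are small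
   uniformly in the real part. *)
have y20 : 0 < y / 2 by rewrite divr_gt0.
have [C C0 aC] := coef_bound (Hpt 0 y20) fa; rewrite /= in aC.
have yy2 : 0 < y - y / 2 by rewrite {1}[y]splitr addrK.
pose r := expR (- (c * (y - y / 2))).
have r01 : 0 <= r < 1 by rewrite expR_ge0 expRN_lt1.
pose D := C * expR (- (c * m%:~R * (y - y / 2))) / (1 - r).
have tB J t : complex.Im (val t) = y -> normc (psum h a m J t) <= B + D * r ^+ J.
  move=> ty; have -> : psum h a m J t = f t - (f t - psum h a m J t) by ring.
  apply: le_trans (normcB _ _) _; apply: lerD; first exact: fB.
  have := @tail_bound _ _ _ _ _ t J am fa C0 aC; rewrite ty -subr_gt0.
  by move=> /(_ yy2) H; apply: le_trans H _; rewrite /D mulrAC.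
pose z0 : R[i] := (0 +i* y)%C.
suff : normc (a n * qc h n z0) <= B.
  by rewrite normcM normc_qc expRN ler_pdivrMr ?expR_gt0.
apply/ler_addgt0Pr => e e0.
(* [i < J] puts the index [n = m + i] into the partial sum; the indices there are pairwise
   incongruent modulo [J], so the average picks up no other one. *)
have [J iJ DJ] := exprn_small D i r01 e0.
apply: le_trans (lerD (lexx B) DJ).
have J0 : (0 < J)%N by apply: leq_trans iJ.
pose pt (l : nat) : H := @Hpt (l%:R * h%:R / J%:R) y y0.
have ptE l (k : int) : qpow h k (pt l) = qc h k z0 * qc J (k * l%:Z) 1.
  rewrite -[LHS]/(qc h k (val (pt l))).
  have -> : val (pt l) = z0 + (l%:R * h%:R / J%:R : R)%:C%C.
    by apply/eqP; rewrite eq_complex /= add0r addr0 !eqxx.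
  rewrite qcDr; congr (_ * _); rewrite !qcE; congr cexp.
  rewrite mulr1 mulrCA -rmorphM /= mulrC; congr (_ %:C%C * _).
  by rewrite intrM -pmulrn; field; rewrite !pnatr_eq0 -!lt0n J0 h0.
have avg : \sum_(l < J) psum h a m J (pt l) * qc J (- n * l%:Z) 1 =
    J%:R * (a n * qc h n z0).
  rewrite /psum; under eq_bigr => l _ do rewrite big_mkord mulr_suml.
  have term l (k : int) : a k * qpow h k (pt l) * qc J (- n * l%:Z) 1 =
      a k * qc h k z0 * qc J ((k - n) * l%:Z) 1.
    rewrite ptE mulrDl qcDl.
    by move: (qc h k z0) (qc J (k * _) 1) (qc J (- n * _) 1) => u v w; ring.
  under eq_bigr => l _ do under eq_bigr => j _ do rewrite term.
  rewrite exchange_big /= (bigD1 (Ordinal iJ)) //= [X in _ + X]big1 => [|j ji].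
    rewrite addr0 -ni subrr; under eq_bigr => l _ do rewrite mul0r qc0 mulr1.
    by rewrite sumr_const card_ord mulr_natl.
  rewrite -mulr_sumr sum_qc // ifN ?mulr0 //.
  have -> : m + j%:Z - n = j%:Z - i%:Z by rewrite ni; ring.
  by rewrite -eqz_mod_dvd !modz_small ?ltz_nat ?iJ ?ltn_ord.
have J0R : 0 < J%:R :> R by rewrite ltr0n.
rewrite -(ler_pM2l J0R) -[X in X * normc _]normc_nat -normcM -avg.
apply: le_trans (normc_sum _ _ _) _.
have -> : J%:R * (B + D * r ^+ J) = \sum_(l < J) (B + D * r ^+ J).
  by rewrite sumr_const card_ord mulr_natl.
apply: ler_sum => l _; rewrite normcM normc_qc /= mulr0 oppr0 expR0 mulr1.
exact: tB.
Qed.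

End Tail.

(** Apply [cauchy_bound] with [B = 0] to the expansion of [- f + f] with coefficients [b - a]. *)
Lemma qexpansion_inj h f a b : (0 < h)%N ->
  qexpansion h f a -> qexpansion h f b -> a = b.
Proof.
move=> h0 fa fb; apply/funext => n.
have H := @cauchy_bound h h0 _ _ 0 1 (qexpansion_linear (-1) fa fb) ltr01.
have : normc (-1 * a n + b n) <= 0.
  apply: le_trans (H _ n) _; last by rewrite mul0r.
  by move=> t _; rewrite mulN1r addNr normc0.
move=> le0; have /eqP : normc (-1 * a n + b n) = 0.
  by apply/eqP; rewrite eq_le le0 normc_ge0.
move=> /eqP/eq0_normc; rewrite mulN1r addrC => /eqP; rewrite subr_eq0 => /eqP //.
Qed.

Lemma qexpansion0 h f a : qexpansion h f a -> (forall n, a n = 0) -> forall t, f t = 0.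
Proof.
move=> fa a0 t; apply: eq0_normc; apply/eqP; rewrite eq_le normc_ge0 andbT.
apply/ler_addgt0Pr => e e0; rewrite add0r.
have [J0 HJ0] := @qexpansion_lim h f a 0 (fun n _ => a0 n) fa t e e0.
have := HJ0 _ (leqnn _); rewrite /psum big1 ?subr0 => [/ltW //|i _].
by rewrite a0 mul0r.
Qed.

End QExpansion.

(** * Reduced elements of a filtered vector space *)

Section LinSpan.
Variables (K : fieldType) (V : lmodType K).
Implicit Types (B : set V) (u v : V).

Lemma lin_span0 B : lin_span B 0.
Proof.
by exists 0%N, (fun _ => 0), (fun _ => 0); split=> [[]|]; rewrite ?big_ord0.
Qed.

Lemma lin_spanDZ B (c : K) u v : B u -> lin_span B v -> lin_span B (c *: u + v).
Proof.
move=> Bu [n [w [d [Bw ->]]]].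
exists n.+1, (fun i => if unlift ord0 i is Some j then w j else u),
  (fun i => if unlift ord0 i is Some j then d j else c); split.
  by move=> i; case: unliftP.
rewrite big_ord_recl unlift_none; congr (_ + _).
by apply: eq_bigr => i _; rewrite liftK.
Qed.

Lemma lin_spanS B B' : B `<=` B' -> lin_span B `<=` lin_span B'.
Proof.
by move=> BB' _ [n [w [d [Bw ->]]]]; exists n, w, d; split=> // i; exact: BB'.
Qed.

End LinSpan.

Section ReducedBasis.
Variables (K : fieldType) (V : lmodType K) (W : set V).
(** To be used with the space of forms for [W], q-coefficients for [co] and inverses of [s_mult] for
    [s]. Together [co_lb] and [co_top] give every nonzero element an order, less than [top], so that
    elimination terminates. *)
Variables (co : V -> int -> K) (s : int -> K) (top : int).
Hypothesis W0 : W 0.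
Hypothesis WDZ : forall (c : K) u v, W u -> W v -> W (c *: u + v).
Hypothesis coDZ : forall (c : K) u v (n : int),
  W u -> W v -> co (c *: u + v) n = c * co u n + co v n.
Hypothesis co_lb : forall u, W u -> exists m, forall n, n < m -> co u n = 0.
Hypothesis co_top : forall u, W u -> (forall n, n < top -> co u n = 0) -> u = 0.
Hypothesis s_neq0 : forall n, s n != 0.

Definition leads u (c : K) (n : int) := (forall i, i < n -> co u i = 0) /\ co u n = c.

Definition is_order (n : int) := exists g, W g /\ leads g 1 n.

Definition red (n : int) u :=
  [/\ W u, leads u (s n) n & forall i, n < i -> co u i != 0 -> ~ is_order i].

Definition order_ge (m : int) := [set u | W u /\ forall n, n < m -> co u n = 0].

Lemma co0 n : co 0 n = 0.
Proof.
have := coDZ 1 n W0 W0; rewrite scaler0 addr0 mul1r => /eqP.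
by rewrite -subr_eq subrr => /eqP.
Qed.

Lemma coZ c u n : W u -> co (c *: u) n = c * co u n.
Proof. by move=> Wu; rewrite -[c *: u]addr0 coDZ // co0 addr0. Qed.

Lemma WZ c u : W u -> W (c *: u).
Proof. by move=> Wu; rewrite -[c *: u]addr0; exact: WDZ. Qed.

Lemma W_sum n (v : 'I_n -> V) (c : 'I_n -> K) : (forall i, W (v i)) ->
  W (\sum_(i < n) c i *: v i) /\
  forall j, co (\sum_(i < n) c i *: v i) j = \sum_(i < n) c i * co (v i) j.
Proof.
elim: n v c => [|n IH] v c Wv; first by rewrite big_ord0; split=> // j; rewrite big_ord0 co0.
rewrite big_ord_recl; have [WS cS] := IH _ (fun i => c (lift ord0 i)) (fun i => Wv (lift ord0 i)).
by split=> [|j]; [exact: WDZ | rewrite coDZ // big_ord_recl cS].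
Qed.

Lemma order_leading u n : W u -> (forall i, i < n -> co u i = 0) -> co u n != 0 ->
  is_order n.
Proof.
move=> Wu u0 un; exists ((co u n)^-1 *: u); split; first exact: WZ.
by split=> [i /u0 ui|]; rewrite coZ ?ui ?mulr0 // mulVf.
Qed.

Lemma order_lt_top n : is_order n -> n < top.
Proof.
move=> [g [Wg [g0 g1]]]; rewrite ltNge; apply/negP => topn.
have g_eq0 : g = 0 by apply: co_top => // i itop; apply: g0; exact: lt_le_trans topn.
by move: g1; rewrite g_eq0 co0 => /eqP; rewrite eq_sym oner_eq0.
Qed.

Lemma neq0_leading u : W u -> u != 0 ->
  exists n, (forall i, i < n -> co u i = 0) /\ co u n != 0.
Proof.
move=> Wu u0; have [m um] := co_lb Wu.
have [d ud] : exists d : nat, co u (m + d%:Z) != 0.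
  apply: contrapT => nex; move/eqP: u0; apply; apply: co_top => // n _.
  have [/um //|mn] := ltP n m.
  have [d ->] := int_le_natP mn.
  by apply/eqP; apply/negPn/negP => ud; apply: nex; exists d.
have ex : exists d : nat, (fun d : nat => co u (m + d%:Z) != 0) d by exists d.
case: (ex_minnP ex) => {ud ex}d ud dmin; exists (m + d%:Z); split=> // i id.
have [/um //|mi] := ltP i m.
have [j ij] := int_le_natP mi.
apply/eqP/negPn/negP => ui; move: id; rewrite ij ltrD2l ltz_nat ltnNge.
by rewrite dmin // -ij.
Qed.

Lemma red_order n u : red n u -> is_order n.
Proof. by case=> Wu [u0 un] _; apply: (order_leading Wu u0); rewrite un. Qed.

(** Echelon form: [u] vanishes below its own order, and above it [u] has no nonzero coefficient at
    an order, which [n'] is because of [u']. *)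
Lemma red_co n n' u u' : red n u -> red n' u' -> n != n' -> co u n' = 0.
Proof.
move=> ru ru'; have := red_order ru'; case: ru => _ [u0 _] uh o' nn'.
have [n'n|nn'' |E] := ltgtP n' n; first exact: u0.
  by apply/eqP/negPn/negP => /(uh _ nn''); apply.
by rewrite E eqxx in nn'.
Qed.

(** A nonzero difference would have an order [j]. Both elements vanish at [j] if [j < n] or, being
    reduced, if [j > n], and they agree at [n]. *)
Lemma red_uniq n u v : red n u -> red n v -> u = v.
Proof.
move=> ru rv; have [Wu [u0 un] uh] := ru; have [Wv [v0 vn] vh] := rv.
apply/eqP; rewrite -subr_eq0; apply/negPn/negP => uv.
have dE : u - v = (-1) *: v + u by rewrite scaleN1r addrC.
have Wd : W (u - v) by rewrite dE; exact: WDZ.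
have cd i : co (u - v) i = co u i - co v i by rewrite dE coDZ // mulN1r addrC.
have [j [dj0 dj]] := neq0_leading Wd uv.
have oj := order_leading Wd dj0 dj.
move: dj; have [jn|nj|->] := ltgtP j n.
- by rewrite cd u0 // v0 // subrr eqxx.
- rewrite cd; have -> : co u j = 0 by apply/eqP/negPn/negP => /(uh _ nj); apply.
  have -> : co v j = 0 by apply/eqP/negPn/negP => /(vh _ nj); apply.
  by rewrite subrr eqxx.
- by rewrite cd un vn subrr eqxx.
Qed.

(** The coefficient at the order of [v i] isolates [c i]: by [red_co] vectors of other orders
    contribute nothing there, and by [red_uniq] one of the same order is [v i] itself. *)
Lemma red_independent : lin_independent [set u | exists n, red n u].
Proof.
move=> n v c vinj vred sum0 i.
have Wv j : W (v j) by have [k []] := vred j.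
have [k rk] := vred i; have [_ [_ vk] _] := rk.
have [_ cS] := W_sum c Wv; have := cS k; rewrite sum0 co0 (bigD1 i) //=.
rewrite big1 => [|j ji].
  by rewrite addr0 vk => /esym/eqP; rewrite mulf_eq0 (negPf (s_neq0 _)) orbF => /eqP.
have [l rl] := vred j; rewrite (red_co rl rk) ?mulr0 //.
apply: contra ji => /eqP lk; apply/eqP/vinj; apply: red_uniq rl _.
by rewrite lk.
Qed.

(** Gaussian elimination by increasing index: a correction with leading term at [j] leaves the
    indices below [j], already cleared, undisturbed. The corrections are collected in [h]. *)
Lemma clear_orders m u d : order_ge m u -> exists2 h, order_ge (m + 1) h &
  forall i, is_order i -> m < i < m + 1 + d%:Z -> co (u - h) i = 0.
Proof.
move=> [Wu u0]; have cB h i : W h -> co (u - h) i = co u i - co h i.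
  by move=> Wh; rewrite addrC -scaleN1r coDZ // mulN1r addrC.
elim: d => [|d [h [Wh h0] hd]].
  exists 0; first by split=> // n _; rewrite co0.
  by move=> i _; rewrite addr0 ltzD1 => /andP[mi im]; move: (lt_le_trans mi im); rewrite ltxx.
pose j := m + 1 + d%:Z.
have jE : m + 1 + d.+1%:Z = j + 1 by rewrite intS /j; ring.
have mj : m + 1 <= j by rewrite lerDl.
have [[g [Wg [g0 g1]]]|noj] := pselect (is_order j); last first.
  exists h => // i oi; rewrite jE ltzD1 le_eqVlt => /andP[mi /orP[/eqP ij|ij]].
    by rewrite ij in oi.
  by apply: hd => //; rewrite mi.
exists (co (u - h) j *: g + h).
  split=> [|n nm]; first exact: WDZ.
  by rewrite coDZ // h0 // g0 ?mulr0 ?addr0 //; exact: lt_le_trans mj.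
move=> i oi; rewrite jE ltzD1 le_eqVlt => /andP[mi /orP[/eqP ->|ij]].
  by rewrite cB ?coDZ //; [rewrite g1 mulr1 cB // | exact: WDZ]; ring.
rewrite cB; last exact: WDZ.
by rewrite coDZ // (g0 i ij) mulr0 add0r -cB // hd // mi.
Qed.

(** Clearing the orders between [n] and [top] suffices, as no order reaches [top]. *)
Lemma red_exists n : is_order n -> exists u, red n u.
Proof.
move=> on; have [g [Wg [g0 g1]]] := on.
have [d dE] := int_le_natP (ltW (order_lt_top on)).
have Gg : order_ge n (s n *: g).
  by split=> [|i /g0 gi]; [exact: WZ | rewrite coZ // gi mulr0].
have [h [Wh h0] hd] := clear_orders d Gg.
have cB i : co (s n *: g - h) i = s n * co g i - co h i.
  by rewrite addrC -scaleN1r coDZ ?mulN1r ?coZ 1?addrC //; exact: WZ.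
exists (s n *: g - h); split.
- by rewrite addrC -scaleN1r; apply: WDZ => //; exact: WZ.
- split=> [i ni|]; rewrite cB ?g1 ?mulr1 h0 ?subr0 ?g0 ?mulr0 //.
  + by rewrite (lt_trans ni) // ltzD1.
  + by rewrite ltzD1.
- move=> i ni + oi; rewrite hd ?eqxx // ni /=.
  by rewrite (lt_trans (order_lt_top oi)) // dE addrAC ltzD1.
Qed.

Lemma red_span m : lin_span [set u | exists n, m <= n /\ red n u] = order_ge m.
Proof.
apply/seteqP; split=> [_ [n [v [c [vB ->]]]]|].
  have Wv j : W (v j) by have [k [_ []]] := vB j.
  have [WS cS] := W_sum c Wv; split=> // i im; rewrite cS big1 // => j _.
  by have [k [mk [_ [v0 _] _]]] := vB j; rewrite v0 ?mulr0 // (lt_le_trans im).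
(* Descending induction on [m], with [d] bounding the distance to [top]: past [top] only 0 is left,
   and before it a multiple of the reduced element of order [m] removes the coefficient at [m]. *)
suff main d : forall m : int, top <= m + d%:Z ->
    order_ge m `<=` lin_span [set u | exists n, m <= n /\ red n u].
  have [le_top|/ltW/int_le_natP[d dE]] := leP top m; first by apply: (main 0%N); rewrite addr0.
  by apply: (main d); rewrite dE.
elim: d => [|d IH] {}m topm u [Wu u0].
  rewrite (co_top Wu) => [|n ntop]; [exact: lin_span0 | apply: u0].
  by apply: lt_le_trans ntop _; rewrite addr0 in topm.
have topm1 : top <= m + 1 + d%:Z by rewrite -addrA -intS.
have sub : [set u | exists n, m + 1 <= n /\ red n u] `<=` [set u | exists n, m <= n /\ red n u].
  by move=> v [n [mn rn]]; exists n; split=> //; apply: le_trans mn; rewrite lerDl.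
have [um|um] := eqVneq (co u m) 0.
  apply: (lin_spanS sub); apply: IH => //; split=> // n; rewrite ltzD1 le_eqVlt.
  by case/orP => [/eqP -> //|/u0].
have [v rv] := red_exists (order_leading Wu u0 um).
have [Wv [v0 vm] _] := rv.
have -> : u = (co u m / s m) *: v + (u - (co u m / s m) *: v) by rewrite addrC subrK.
apply: lin_spanDZ; first by exists m.
apply: (lin_spanS sub); apply: IH => //.
rewrite [u - _]addrC -scaleNr; split=> [|n]; first exact: WDZ.
rewrite ltzD1 le_eqVlt coDZ // => /orP[/eqP ->|nm]; last by rewrite (u0 n nm) (v0 n nm) mulr0 addr0.
by rewrite vm mulNr divfK // addNr.
Qed.

Lemma red_basis_ge m :
  is_basis [set u | exists n, m <= n /\ red n u] (order_ge m).
Proof.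
split; last exact: red_span.
move=> n v c vinj vB; apply: red_independent => // i.
by have [k [_ rk]] := vB i; exists k.
Qed.

Lemma red_basis : is_basis [set u | exists n, red n u] W.
Proof.
split; first exact: red_independent.
apply/seteqP; split=> [_ [n [v [c [vB ->]]]]|u Wu].
  by apply: (W_sum c _).1 => j; have [k []] := vB j.
have [m um] := co_lb Wu.
have : order_ge m u by [].
rewrite -red_span; apply: lin_spanS => v [n [_ rn]]; by exists n.
Qed.

End ReducedBasis.

(** * The characters *)

Section Arith.

Lemma legendre_mod (p : nat) (m n : int) :
  (m == n %[mod p%:Z])%Z -> legendre p m = legendre p n.
Proof.
move=> mn; rewrite /legendre; have -> : (p%:Z %| m)%Z = (p%:Z %| n)%Z.
  by apply/dvdz_mod0P/dvdz_mod0P; rewrite (eqP mn).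
case: ifP => // _; congr (if _ then _ else _); apply: eq_existsb => x.
by rewrite (eqP mn).
Qed.

Lemma legendre1 (p : nat) : (1 < p)%N -> legendre p 1 = 1.
Proof.
move=> p1; rewrite /legendre dvdzE /= dvdn1 gtn_eqF //.
by case: ifPn => // /existsP[]; exists (Ordinal p1); rewrite expr1n.
Qed.

(** Squaring modulo [p] identifies 1 and [p - 1], so on a finite set it misses some [y]; this [y] is
    not 0, which is a square. *)
Lemma legendre_nonresidue (p : nat) : prime p -> odd p ->
  exists n, legendre p n = -1.
Proof.
move=> pp op; have p2 : (2 < p)%N by rewrite odd_prime_gt2.
have p0 : (0 < p)%N by apply: ltn_trans p2.
pose f (x : 'I_p) : 'I_p := Ordinal (ltn_pmod (x ^ 2) p0).
have [/existsP[y yf]|] := boolP [exists y, y \notin codom f]; last first.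
  rewrite negb_exists => /forallP fsurj; exfalso.
  have finj : {in predT &, injective f}.
    by apply/image_injP/eqP; apply: eq_card => y; rewrite inE; exact: negbNE (fsurj y).
  have p1 : (1 < p)%N by apply: ltn_trans p2.
  have pp1 : (p.-1 < p)%N by rewrite prednK.
  suff : Ordinal p1 = Ordinal pp1 by move=> /(congr1 val) /=; lia.
  apply: finj => //; apply/val_inj => /=.
  have -> : (p.-1 ^ 2 = 1 + (p - 2) * p)%N.
    by case: (p) p2 => [|[|q]] // _; rewrite /= subSS subSS subn0 -mulnn; nia.
  by rewrite addnC modnMDl.
exists (y : nat)%:Z; rewrite /legendre dvdzE /=.
have y0 : (0 < y)%N.
  rewrite lt0n; apply: contra yf => /eqP y0; apply/codomP; exists (Ordinal p0).
  by apply: val_inj; rewrite /= y0 mod0n.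
rewrite gtnNdvd //; case: ifPn => // /existsP[x /eqP xy]; case/codomP: yf.
exists x; apply: val_inj => /=; move: xy; rewrite expr2 -PoszM !modz_nat => -[].
by rewrite mulnn => ->; rewrite modn_small.
Qed.

Lemma chi_prime_norm_le1 (p : nat) (n : int) : `|chi_prime p n| <= 1.
Proof. by rewrite /chi_prime /kronecker_m4 /legendre; do !case: ifP. Qed.

Lemma chi_norm_le1 (N : nat) (n : int) : `|chi N n| <= 1.
Proof.
rewrite /chi; elim/big_rec: _ => [//|p x _ x1].
by rewrite normrM mulr_ile1 ?chi_prime_norm_le1.
Qed.

(** For [e = -1] the class of 1 serves, for [e = 1] that of a nonresidue, or of 3 modulo 4. Oddness
    of [n0] at [p = 2] will make the weight of the translate [j = 2] equal to -1. *)
Lemma forbidden_residue (p : nat) (e : int) : prime p -> e = 1 \/ e = -1 ->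
  exists n0 : int, (p = 2%N -> ~~ (2 %| n0)%Z) /\ forall n : int,
    (n == n0 %[mod (if p == 2%N then 4 else p%:Z)])%Z -> chi_prime p n = - e.
Proof.
move=> pp; rewrite /chi_prime; case: eqP => [_|/eqP p2].
  by case=> ->; [exists 3 | exists 1]; split=> // n /eqP nn; rewrite /kronecker_m4 nn.
have op : odd p by case: (even_prime pp) p2 => ->.
case=> ->; last first.
  exists 1; split=> [E|n /legendre_mod ->]; first by rewrite E in p2.
  by rewrite legendre1 ?prime_gt1.
have [n0 ln0] := legendre_nonresidue pp op; exists n0.
by split=> [E|n /legendre_mod ->]; first by rewrite E in p2.
Qed.

Lemma kronecker_1mod4 (q : int) : kronecker_m4 (1 + 4 * q) = 1.
Proof. by rewrite /kronecker_m4 addrC mulrC modzMDl. Qed.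

Lemma kronecker_3mod4 (q : int) : kronecker_m4 (3 + 4 * q) = -1.
Proof. by rewrite /kronecker_m4 addrC mulrC modzMDl. Qed.

Lemma odd_intP (c : int) : ~~ (2 %| c)%Z -> exists g, c = 2 * g + 1.
Proof.
move=> c2; exists (c %/ 2)%Z; rewrite {1}(divz_eq c 2) mulrC; congr (_ + _).
have := modz_ge0 c (isT : 2 != 0 :> int); have := ltz_pmod c (isT : 0 < 2 :> int).
have : (c %% 2)%Z != 0 by apply: contra c2 => /eqP/dvdz_mod0P.
lia.
Qed.

Lemma kronecker_even_shift (M a c : int) : ~~ (2 %| M)%Z -> (2 %| a)%Z ->
  ~~ (2 %| c)%Z ->
  exists2 s : int, s = 1 \/ s = -1 & kronecker_m4 (1 + M * (a * c)) = s /\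
    kronecker_m4 (1 + M * ((a + 2 * M * c) * c)) = - s.
Proof.
move=> /odd_intP[m ->] /dvdzP[a' ->] /odd_intP[g ->].
have [/dvdzP[e ->]|/odd_intP[e ->]] := boolP (2 %| a')%Z.
  exists 1; first by left.
  split.
    rewrite -[RHS](kronecker_1mod4 ((2 * m + 1) * e * (2 * g + 1))).
    by congr kronecker_m4; ring.
  (* Chosen so that [(2 m + 1) (2 g + 1) = 2 w + 1]. *)
  pose w := 2 * m * g + m + g.
  rewrite -[RHS](kronecker_3mod4 ((2 * m + 1) * e * (2 * g + 1) + 2 * w * w + 2 * w)).
  by congr kronecker_m4; rewrite /w; ring.
exists (-1); first by right.
pose w := 2 * m * g + m + g.
rewrite opprK; split.
  rewrite -[RHS](kronecker_3mod4 ((2 * m + 1) * e * (2 * g + 1) + w)).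
  by congr kronecker_m4; rewrite /w; ring.
rewrite -[RHS](kronecker_1mod4 ((2 * m + 1) * e * (2 * g + 1) + 3 * w + 2 * w * w + 1)).
by congr kronecker_m4; rewrite /w; ring.
Qed.

Variable N : nat.
Hypothesis hN : (1 < N)%N.
Hypothesis hodd : squarefree (N`_2^')%N.
Hypothesis h2 : (N`_2 = 1 \/ N`_2 = 4)%N.

(** The first factor is the full [p]-part of [N]: it is 4 at 2, where divisibility excludes a
    trivial 2-part, and for odd [p] a divisor [p ^ 2] would contradict squarefreeness of the odd
    part. *)
Lemma prime_part (p : nat) : p \in primes N -> exists M : nat,
  N = ((if p == 2%N then 4 else p) * M)%N /\ ~~ (p %| M)%N.
Proof.
rewrite mem_primes => /and3P[pp N0 pN].
have NE : (N = N`_2 * N`_2^')%N by rewrite partnC.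
case: eqP => [p2|/eqP p2].
  rewrite p2 in pN *; case: h2 => N2.
    have := partn_dvd 2%N N0 pN; rewrite N2 part_pnat_id ?dvdn1 //.
  exists (N`_2^')%N; rewrite -N2; split=> //.
  rewrite -prime_coprime //; have := coprime_partC 2%N N N.
  by rewrite N2 -[4%N]/(2 ^ 2)%N coprime_pexpl.
exists (N %/ p)%N; rewrite mulnC divnK //; split=> //; apply/negP => pM.
have pp2N : (p ^ 2 %| N)%N by rewrite -(divnK pN) -mulnn dvdn_mul.
have := partn_dvd 2^'%N N0 pp2N.
rewrite part_pnat_id; last by rewrite pnatX pnatE ?inE // p2.
by move=> /hodd pE; rewrite pE in pp.
Qed.

Lemma dvd_cofactor (p l Q M : nat) : prime p -> (Q = if p == 2%N then 4 else p)%N ->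
  N = (Q * M)%N -> l \in primes N -> l != p -> (l %| M)%N.
Proof.
move=> pp QE NE; rewrite mem_primes => /and3P[pl _ lN] lp.
move: lN; rewrite NE Gauss_dvdr // QE; case: eqP => [p2|_].
  by rewrite -[4%N]/(2 ^ 2)%N coprimeXr // prime_coprime // dvdn_prime2 // -p2.
by rewrite prime_coprime // dvdn_prime2.
Qed.

(** Every odd prime of [N] divides [M], so its character is 1 at an argument congruent to 1 modulo
    [M]. *)
Lemma chi_shift (M : nat) (y : int) : N = (4 * M)%N -> ~~ (2 %| M)%N ->
  chi N (1 + M%:Z * y) = kronecker_m4 (1 + M%:Z * y).
Proof.
move=> NE M2; have N0 : (0 < N)%N by apply: ltnW.
have two : 2%N \in primes N by rewrite mem_primes N0 NE dvdn_mulr.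
rewrite /chi (bigD1_seq 2%N) ?primes_uniq //= big1_seq ?mulr1 //.
move=> l /andP[l2 lN]; have lM : (l %| M)%N by apply: (@dvd_cofactor 2 _ 4).
rewrite /chi_prime (negPf l2) (@legendre_mod _ _ 1).
  by rewrite legendre1 // prime_gt1 //; move: lN; rewrite mem_primes => /and3P[].
have /dvdnP[r ->] := lM.
by rewrite eqz_mod_dvd addrAC subrr add0r PoszM -mulrA dvdz_mull // dvdz_mulr.
Qed.

End Arith.

(** * Modular transformations of f(z / N) *)

Section SL2.

Definition mx22 (a b c d : int) : 'M[int]_2 :=
  \matrix_(i, j) if i == 0 then (if j == 0 then a else b) else (if j == 0 then c else d).

Lemma det_mx2 (A : 'M[int]_2) : \det A = A 0 0 * A 1 1 - A 0 1 * A 1 0.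
Proof.
rewrite (expand_det_row _ 0) !big_ord_recl big_ord0 /cofactor !det_mx11 !mxE /=.
have -> : lift 0 (0 : 'I_1) = 1 :> 'I_2 by exact/val_inj.
have -> : lift 1 (0 : 'I_1) = 0 :> 'I_2 by exact/val_inj.
by rewrite /bump /= !addn0 expr0 expr1; ring.
Qed.

Lemma det_mx22_eq1 (a b c d : int) : a * d - b * c = 1 -> \det (mx22 a b c d) == 1.
Proof. by rewrite det_mx2 !mxE => /eqP. Qed.

Definition sl2 (a b c d : int) (D : a * d - b * c = 1) : SL2Z :=
  exist _ (mx22 a b c d) (det_mx22_eq1 D).

Lemma sl2E (g : SL2Z) : mx g 0 0 * mx g 1 1 - mx g 0 1 * mx g 1 0 = 1.
Proof. by rewrite -det_mx2; apply/eqP; exact: (valP g). Qed.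

End SL2.

Section Slash.
Variable R : realType.
Implicit Types (z w : R[i]) (a b c d : int).

Lemma extend0_val (f : upper_half_plane R -> R[i]) t : extend0 f (val t) = f t.
Proof. by rewrite /extend0 valK. Qed.

(** Integer entries in place of an [SL2Z] matrix can be rewritten freely, with the determinant
    carried as a separate equation. *)
Definition moeb a b c d z : R[i] := (a%:~R * z + b%:~R) / (c%:~R * z + d%:~R).

Lemma Im_moeb_gt0 a b c d z : a * d - b * c = 1 -> 0 < complex.Im z ->
  0 < complex.Im (moeb a b c d z).
Proof.
move=> D z0; have := moebius_subproof (sl2 D) (exist _ z z0).
by rewrite /moebius_fun /denom /mx /= !mxE.
Qed.

(** A zero denominator would make the quotient 0 by the convention for division, against the
    positive imaginary part of the image. *)
Lemma denom_neq0 a b c d z : a * d - b * c = 1 -> 0 < complex.Im z ->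
  c%:~R * z + d%:~R != 0.
Proof.
move=> D z0; apply/negP => /eqP c0; have := Im_moeb_gt0 D z0.
by rewrite /moeb c0 invr0 mulr0 ltxx.
Qed.

Lemma det_complex a b c d : a * d - b * c = 1 ->
  a%:~R * d%:~R - b%:~R * c%:~R = 1 :> R[i].
Proof. by move=> D; rewrite -!intrM -intrB D. Qed.

Variables (N : nat) (k : int) (f : upper_half_plane R -> R[i]).
Hypothesis hN : (1 < N)%N.
Hypothesis f_slash : forall g : SL2Z, in_Gamma0 N g ->
  slash k f g = (chi N (mx g 1 1))%:~R *: f.

Lemma automorphy a b c d z : a * d - b * c = 1 -> (N%:Z %| c)%Z ->
  0 < complex.Im z ->
  extend0 f (moeb a b c d z) =
    (chi N d)%:~R * (c%:~R * z + d%:~R) ^ k * extend0 f z.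
Proof.
move=> D Nc z0; have cz := denom_neq0 D z0.
have := @f_slash (sl2 D); rewrite /in_Gamma0 /mx /= mxE => /(_ Nc).
pose t : upper_half_plane R := exist _ z z0.
move=> /(congr1 (fun F => F t)) E0.
have e1 : f (moebius (sl2 D) t) = extend0 f (moeb a b c d z).
  rewrite -(extend0_val f (moebius _ _)); congr extend0.
  by rewrite /= /moebius_fun /denom /mx /= !mxE.
have e2 : f t = extend0 f z by rewrite -(extend0_val f t).
have E : (c%:~R * z + d%:~R) ^ (- k) * extend0 f (moeb a b c d z) =
    (chi N d)%:~R * extend0 f z.
  by rewrite -e1 -e2; move: E0; rewrite /slash /denom /mx /= !mxE.
by rewrite mulrAC -E mulrAC -expfzDr // addNr expr0z mul1r.
Qed.

(* The weight [k] action on [z |-> f (z / N)]. *)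
Definition slash_scaled a b c d z : R[i] :=
  (c%:~R * z + d%:~R) ^ (- k) * extend0 f (moeb a b c d z / N%:R).

Lemma Im_divN z : complex.Im (z / N%:R) = complex.Im z / N%:R.
Proof.
have -> : (N%:R : R[i])^-1 = (N%:R^-1 : R)%:C%C by rewrite fmorphV rmorph_nat.
by case: z => x y /=; rewrite mulr0 add0r.
Qed.

Let N0 : (0 : R) < N%:R. Proof. by rewrite ltr0n ltnW. Qed.
Let N0C : (N%:R : R[i]) != 0. Proof. by rewrite pnatr_eq0 -lt0n ltnW. Qed.

(** For the matrices [g] and [g'] of the two actions, [g' g^(-1)] is [(p, q1 N; r, s)]. Conjugation
    by diag(N, 1) turns it into [(p, q1; r N, s)] in Gamma0(N), to which [automorphy] applies at the
    point [w / N]. *)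
Lemma slash_scaled_proportional a b c d a' b' c' d' z : a * d - b * c = 1 ->
  a' * d' - b' * c' = 1 -> (N%:Z %| a * b' - a' * b)%Z -> 0 < complex.Im z ->
  slash_scaled a' b' c' d' z = (chi N (d' * a - c' * b))%:~R * slash_scaled a b c d z.
Proof.
move=> D D' /dvdzP[q1 qE] z0.
have cz := denom_neq0 D z0; have cz' := denom_neq0 D' z0.
pose p := a' * d - b' * c; pose r := c' * d - d' * c; pose s := d' * a - c' * b.
have Db : p * s - q1 * (r * N%:Z) = 1.
  have -> : p * s - q1 * (r * N%:Z) = p * s - q1 * N%:Z * r by ring.
  rewrite -qE; transitivity ((a * d - b * c) * (a' * d' - b' * c')); last by rewrite D D' mul1r.
  by rewrite /p /r /s; ring.
have w0 := Im_moeb_gt0 D z0; set w := moeb a b c d z in w0.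
have t0 : 0 < complex.Im (w / N%:R) by rewrite Im_divN divr_gt0.
have := automorphy Db (dvdz_mull r (dvdzz N%:Z)) t0.
have DC := det_complex D.
have qC : q1%:~R * N%:R = a%:~R * b'%:~R - a'%:~R * b%:~R :> R[i].
  by rewrite -!intrM -intrB qE intrM -pmulrn.
(* The cocycle relation: the automorphy factor of [g' g^(-1)] at [w = g z] is the quotient of those
   of [g'] and [g] at [z]. *)
have denE : (r * N%:Z)%:~R * (w / N%:R) + s%:~R =
    (c'%:~R * z + d'%:~R) / (c%:~R * z + d%:~R) :> R[i].
  have -> : (r * N%:Z)%:~R * (w / N%:R) = r%:~R * w :> R[i].
    by rewrite intrM -pmulrn; field.
  apply: (mulIf cz); rewrite divfK // mulrDl /w /moeb mulrA divfK //.
  rewrite /r /s !rmorphB !rmorphM /= -[RHS]mulr1 -[X in _ = _ * X]DC; ring.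
have numE : p%:~R * (w / N%:R) + q1%:~R =
    (a'%:~R * z + b'%:~R) / (c%:~R * z + d%:~R) / N%:R :> R[i].
  apply: (mulIf N0C); rewrite mulrDl mulrA !divfK // qC.
  apply: (mulIf cz); rewrite divfK // mulrDl /w /moeb mulrA divfK //.
  rewrite /p !rmorphB !rmorphM /= -[RHS]mulr1 -[X in _ = _ * X]DC; ring.
rewrite /moeb denE numE.
have -> : (a'%:~R * z + b'%:~R) / (c%:~R * z + d%:~R) / N%:R /
   ((c'%:~R * z + d'%:~R) / (c%:~R * z + d%:~R)) = moeb a' b' c' d' z / N%:R.
  by rewrite /moeb; field; rewrite N0C cz cz'.
rewrite /slash_scaled => ->; rewrite -/w.
move: cz cz'; set X := c%:~R * z + _; set Y := c'%:~R * z + _ => X0 Y0.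
rewrite expfzMl -invr_expz exprz_inv -!mulrA mulrCA; congr (_ * _).
by rewrite mulKf ?expfz_neq0.
Qed.

Lemma slash_scaled_translate a b c d (n : int) z :
  slash_scaled a b c d (z + n%:~R) = slash_scaled a (a * n + b) c (c * n + d) z.
Proof.
rewrite /slash_scaled /moeb !intrD !intrM.
have E (x y : int) : x%:~R * (z + n%:~R) + y%:~R = x%:~R * z + (x%:~R * n%:~R + y%:~R) :> R[i].
  by ring.
by rewrite !E.
Qed.

End Slash.

(** * The bound over all of SL2(Z) *)

Lemma normc_eq0_small (R : realType) (z : R[i]) (C : R) :
  0 <= C -> (forall e, 0 < e -> normc z <= C * e) -> z = 0.
Proof.
move=> C0 zC; apply: eq0_normc; apply/eqP; rewrite eq_le normc_ge0 andbT.
apply/ler_addgt0Pr => e e0; rewrite add0r.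
have C1 : 0 < C + 1 by rewrite ltr_wpDl.
apply: le_trans (zC _ (divr_gt0 e0 C1)) _.
by rewrite mulrCA ger_pMr // ler_pdivrMr // mul1r lerDl.
Qed.

Section Relation.
Variable R : realType.
Implicit Types (f : upper_half_plane R -> R[i]) (z w : R[i]).

Lemma normc_qc1 h (n : int) : (0 < h)%N -> normc (qc h n (1 : R[i])) = 1.
Proof. by move=> h0; rewrite normc_qc /= mulr0 oppr0 expR0. Qed.

(** Moving [w] by [j M] moves [w / N] by [j / Q], so the weighted sum over [j] projects onto the
    coefficients with [n] congruent to [n0] modulo [Q], all of which vanish. This is exact on
    partial sums, and the remainders at the [Q] points are small together. *)
Lemma residue_relation f (al : int -> R[i]) N Q M (n0 : int) w :
  (0 < Q)%N -> (0 < M)%N -> N = (Q * M)%N -> qexpansion 1 f al ->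
  (forall n, (n == n0 %[mod Q%:Z])%Z -> al n = 0) -> 0 < complex.Im w ->
  \sum_(j < Q) qc Q (- n0 * j%:Z) 1 *
    extend0 f ((w + (j%:Z * M%:Z)%:~R) / N%:R) = 0.
Proof.
move=> Q0 M0 NE fal aln0 w0.
have [m [am _]] := fal.
have N0 : (0 < N)%N by rewrite NE muln_gt0 Q0.
have t0 (j : nat) : 0 < complex.Im ((w + (j%:Z * M%:Z)%:~R) / N%:R).
  rewrite Im_divN divr_gt0 ?ltr0n //.
  have -> : (j%:Z * M%:Z)%:~R = ((j%:Z * M%:Z)%:~R : R)%:C%C :> R[i] by rewrite rmorph_int.
  by case: (w) w0 => x y /=; rewrite addr0.
pose t (j : nat) : upper_half_plane R :=
  exist (fun z : R[i] => 0 < complex.Im z) _ (t0 j).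
have tE (j : nat) (n : int) :
    qpow 1 n (t j) = qc 1 n (w / N%:R) * qc Q (n * j%:Z) 1.
  rewrite -[LHS]/(qc 1 n (val (t j))) /= mulrDl qcDr; congr (_ * _).
  rewrite /qc; congr cexp; rewrite !intrM -!pmulrn NE natrM; field.
  by rewrite !pnatr_eq0 -!lt0n Q0 M0.
have S0 J : \sum_(j < Q) qc Q (- n0 * j%:Z) 1 * psum 1 al m J (t j) = 0.
  rewrite /psum; under eq_bigr => j _ do rewrite big_mkord mulr_sumr.
  rewrite exchange_big /= big1 // => i _; move: (m + _) => n.
  have term (j : nat) : qc Q (- n0 * j%:Z) 1 * (al n * qpow 1 n (t j)) =
      al n * qc 1 n (w / N%:R) * qc Q ((n - n0) * j%:Z) 1.
    rewrite tE mulrDl qcDl.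
    by move: (qc 1 n _) (qc Q (n * _) 1) (qc Q (- n0 * _) 1) => u v x; ring.
  under eq_bigr => j _ do rewrite term.
  rewrite -mulr_sumr sum_qc //; case: ifPn => [nn0|_]; last by rewrite mulr0.
  by rewrite aln0 ?mul0r // eqz_mod_dvd.
apply: (@normc_eq0_small _ _ Q%:R) => // e e0.
have /choice[J HJ] (j : 'I_Q) : exists J0, forall J, (J0 <= J)%N ->
  normc (f (t j) - psum 1 al m J (t j)) < e by exact: qexpansion_lim.
pose J0 := (\max_(j < Q) J j)%N.
have -> : \sum_(j < Q) qc Q (- n0 * j%:Z) 1 *
    extend0 f ((w + (j%:Z * M%:Z)%:~R) / N%:R) =
  \sum_(j < Q) qc Q (- n0 * j%:Z) 1 * (f (t j) - psum 1 al m J0 (t j)).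
  under [RHS]eq_bigr => j _ do rewrite mulrBr.
  rewrite sumrB S0 subr0; apply: eq_bigr => j _.
  by rewrite -(extend0_val f (t j)).
apply: le_trans (normc_sum _ _ _) _.
have -> : Q%:R * e = \sum_(j < Q) e by rewrite sumr_const card_ord mulr_natl.
apply: ler_sum => j _; rewrite normcM normc_qc1 // mul1r ltW // HJ //.
exact: leq_bigmax.
Qed.

End Relation.

(** The value [x] satisfies [x ^+ 2 = 1], and as 4 does not divide [2 n] the sum over the four
    residues gives [1 + x + 1 + x = 0]. *)
Lemma qc4_half (R : realType) (n : int) : ~~ (2 %| n)%Z -> qc 4 (n * 2) (1 : R[i]) = -1.
Proof.
move=> n2; have := sum_qc R (n * 2) (isT : (0 < 4)%N).
rewrite ifN; last by rewrite -[4%:Z]/(2 * 2 : int) dvdz_mul2r.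
set x := qc 4 (n * 2) 1; have xx : qc 4 (n * 2 * 2) (1 : R[i]) = 1.
  by rewrite -mulrA mulrC qc_period.
rewrite !big_ord_recl big_ord0 /= /bump /= mulr0 qc0 mulr1 -/x xx addr0.
rewrite -[(1 + (1 + 1))%N%:Z]/(2 + 1 : int) mulrDr mulr1 qcDl xx mul1r -/x.
have -> : 1 + (x + (1 + x)) = 2 * (x + 1) by ring.
by move/eqP; rewrite mulf_eq0 pnatr_eq0 /= addr_eq0 => /eqP.
Qed.

Section Key.
Variable R : realType.
Variables (N : nat) (k : int) (eps : nat -> int).
Hypothesis hN : (1 < N)%N.
Hypothesis hodd : squarefree (N`_2^')%N.
Hypothesis h2 : (N`_2 = 1 \/ N`_2 = 4)%N.
Hypothesis heps : forall p : nat, p \in primes N -> eps p = 1 \/ eps p = -1.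
Variable f : upper_half_plane R -> R[i].
Hypothesis fA : Aeps N k eps f.

Let f_slash : forall g : SL2Z, in_Gamma0 N g ->
  slash k f g = (chi N (mx g 1 1))%:~R *: f.
Proof. by case: fA => -[]. Qed.

Local Notation wt := (slash_scaled N k f).

(** This is [residue_relation] at [w = g z] times the automorphy factor of [g]; translating [g z] by
    [j M] multiplies [g] on the left by a translation matrix. *)
Lemma slash_scaled_relation Q M (n0 : int) (al : int -> R[i]) a b c d z :
  (0 < Q)%N -> (0 < M)%N -> N = (Q * M)%N -> qexpansion 1 f al ->
  (forall n, (n == n0 %[mod Q%:Z])%Z -> al n = 0) ->
  a * d - b * c = 1 -> 0 < complex.Im z ->
  \sum_(j < Q) qc Q (- n0 * j%:Z) 1 *
    wt (a + j%:Z * M%:Z * c) (b + j%:Z * M%:Z * d) c d z = 0.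
Proof.
move=> Q0 M0 NE fal aln0 D z0; have cz := denom_neq0 D z0.
have w0 := Im_moeb_gt0 D z0.
have := residue_relation Q0 M0 NE fal aln0 w0.
move=> /(congr1 (fun x => (c%:~R * z + d%:~R) ^ (- k) * x)).
rewrite mulr0 mulr_sumr => E; rewrite -[RHS]E; apply: eq_bigr => j _.
rewrite mulrCA; congr (_ * _); rewrite /slash_scaled; congr (_ * extend0 f (_ / _)).
by rewrite /moeb !intrD !intrM; field.
Qed.

(** As [a] is invertible modulo [N], the top row [(a, b)] is proportional to some [(1, j)] modulo
    [N], and up to a factor of norm at most 1 the form is the translate by [j]. *)
Lemma slash_scaled_coprime_bound a b c d z (B : R) : a * d - b * c = 1 -> 0 < complex.Im z ->
  (forall p, p \in primes N -> ~~ (p%:Z %| a)%Z) ->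
  (forall w, complex.Im w = complex.Im z -> normc (extend0 f (w / N%:R)) <= B) ->
  normc (wt a b c d z) <= B.
Proof.
move=> D z0 aN fB.
have B0 : 0 <= B by apply: le_trans (normc_ge0 _) (fB z erefl).
have cop : coprimez a N%:Z.
  rewrite /coprimez /gcdz /= eqz_nat; apply/negPn/negP => g1.
  have g0 : (0 < gcdn `|a| N)%N by rewrite gcdn_gt0 (ltnW hN) orbT.
  have gg1 : (1 < gcdn `|a| N)%N by rewrite ltn_neqAle eq_sym g1.
  have pg := pdiv_dvd (gcdn `|a| N).
  have /aN/negP : pdiv (gcdn `|a| N) \in primes N.
    by rewrite mem_primes pdiv_prime // (ltnW hN) (dvdn_trans pg) ?dvdn_gcdr.
  by apply; rewrite dvdzE /= (dvdn_trans pg) ?dvdn_gcdl.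
have [u [v uv]] : exists u v, u * a + v * N%:Z = 1.
  by have [u [v uv]] := Bezoutz a N%:Z; exists u, v; rewrite uv; apply/eqP; exact: cop.
pose j := b * u.
have D1 : 1 * 1 - j * 0 = 1 by rewrite mulr0 subr0.
rewrite (@slash_scaled_proportional R N k f hN f_slash 1 j 0 1 a b c d z D1 D) //; last first.
  apply/dvdzP; exists (v * b); rewrite /j.
  have -> : 1 * b - a * (b * u) = b * (1 - u * a) by ring.
  by rewrite -uv; ring.
rewrite normcM normc_int.
have chi1 : `|(chi N (d * 1 - c * j))%:~R : R| <= 1.
  by rewrite -intr_norm -[1]/(1%:~R) ler_int chi_norm_le1.
apply: le_trans (ler_wpM2r (normc_ge0 _) chi1) _; rewrite mul1r.
rewrite /slash_scaled /moeb; have -> : 0%:~R * z + 1%:~R = 1 :> R[i] by rewrite mul0r add0r.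
rewrite exp1rz !mul1r divr1; apply: fB.
have -> : j%:~R = (j%:~R : R)%:C%C :> R[i] by rewrite rmorph_int.
by case: (z) => x y /=; rewrite addr0.
Qed.

(** Induction on a list [s] containing the primes of [N] that divide [a]: the relation attached to
    such a [p], combined with a translation when [p = 2], bounds the form by others whose top-left
    entry is prime to [p], at the cost of a factor [N]. *)
Lemma slash_scaled_bound (s : seq nat) a b c d z (B : R) :
  a * d - b * c = 1 -> 0 < complex.Im z ->
  (forall p, p \in primes N -> (p%:Z %| a)%Z -> p \in s) ->
  (forall w, complex.Im w = complex.Im z -> normc (extend0 f (w / N%:R)) <= B) ->
  normc (wt a b c d z) <= N%:R ^+ size s * B.
Proof.
move=> + + + fB; have B0 : 0 <= B by apply: le_trans (normc_ge0 _) (fB z erefl).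
have N1 : 1 <= N%:R :> R by rewrite ler1n ltnW.
elim: s a b c d z fB => [|p s IH] a b c d z fB D z0 bad.
  rewrite expr0 mul1r; apply: slash_scaled_coprime_bound => // p pN; apply/negP => pa.
  by have := bad p pN pa.
have [/andP[pN pa]|npa] := boolP ((p \in primes N) && (p%:Z %| a)%Z); last first.
  apply: le_trans (IH a b c d z fB D z0 _) _.
    move=> l lN la; have := bad l lN la; rewrite inE => /orP[/eqP lp|//].
    by rewrite -lp lN la in npa.
  by rewrite /= ler_wpM2r // exprS ler_peMl // exprn_ge0.
have [pp N0 _] := and3P (etrans (esym (mem_primes p N)) pN).
have [n0 [n02 n0P]] := forbidden_residue pp (heps pN).
have [M [NE pM]] := prime_part hodd h2 pN.
have M0 : (0 < M)%N by move: N0; rewrite NE muln_gt0 => /andP[].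
set Q := (if p == 2%N then 4 else p)%N in NE.
have Q0 : (0 < Q)%N by rewrite /Q; case: ifP => // _; exact: prime_gt0.
have [_ [al [fal alP]]] := fA.
have aln0 n : (n == n0 %[mod Q%:Z])%Z -> al n = 0.
  by move=> nn0; apply: (alP n p pN); apply: n0P; rewrite -(fun_if Posz) -/Q in nn0 *.
have pc : ~~ (p%:Z %| c)%Z.
  apply/negP => pc; have : (p%:Z %| a * d - b * c)%Z.
    by apply: rpredB; [exact: dvdz_mulr | exact: dvdz_mull].
  by rewrite D dvdzE /= dvdn1 gtn_eqF // prime_gt1.
pose wj (j : nat) w := wt (a + j%:Z * M%:Z * c) (b + j%:Z * M%:Z * d) c d w.
(* Neither [M] nor [c] is divisible by [p], so [a + j M c] is prime to [p]; modulo the other primes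
   of [N], which divide [M], it is still [a]. *)
have wj_bound (j : nat) w : ~~ (p %| j)%N -> complex.Im w = complex.Im z ->
    normc (wj j w) <= N%:R ^+ size s * B.
  move=> pj wz; apply: IH; rewrite ?wz //; first by rewrite -D; ring.
  move=> l lN; have [->|lp] := eqVneq l p.
    rewrite rpredDl //  => /idP; rewrite !dvdzE /= in pc *.
    rewrite !abszM /= !Euclid_dvdM // (negPf pj) (negPf pM) (negPf pc) //.
  have lM := dvd_cofactor pp (erefl Q) NE lN lp.
  rewrite rpredDr; last by rewrite dvdz_mulr // dvdz_mull.
  by move=> /(bad _ lN); rewrite inE (negPf lp).
have rel w : complex.Im w = complex.Im z ->
    \sum_(j < Q) qc Q (- n0 * j%:Z) 1 * wj j w = 0.
  by move=> wz; apply: slash_scaled_relation fal aln0 _ _ => //; rewrite wz.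
have wj0 w : wj 0%N w = wt a b c d w by rewrite /wj !mul0r !addr0.
have [p2|p2] := eqVneq p 2%N; last first.
  have QE : Q = p by rewrite /Q (negPf p2).
  have := rel z erefl; rewrite (bigD1 (Ordinal Q0)) //= mulr0 qc0 mul1r wj0.
  move/eqP; rewrite addr_eq0 => /eqP ->; rewrite normcN.
  apply: le_trans (normc_sum _ _ _) _.
  apply: (@le_trans _ _ (\sum_(j < Q) N%:R ^+ size s * B)).
    rewrite [leRHS](bigD1 (Ordinal Q0)) //= ler_wpDl ?mulr_ge0 ?exprn_ge0 //.
    apply: ler_sum => j j0; rewrite normcM normc_qc1 // mul1r wj_bound //.
    by rewrite gtnNdvd -?QE // lt0n; apply: contra j0 => /eqP j0; apply/eqP/val_inj.
  rewrite sumr_const card_ord -[leLHS]mulr_natl /= exprS -mulrA ler_wpM2r ?mulr_ge0 ?exprn_ge0 //.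
  by rewrite ler_nat NE leq_pmulr.
have QE : Q = 4%N by rewrite /Q p2.
rewrite p2 in n02 pM pa pc wj_bound; rewrite QE in rel NE.
set b0 := N%:R ^+ size s * B in wj_bound.
have b00 : 0 <= b0 by rewrite mulr_ge0 ?exprn_ge0.
(* At [p = 2] the entry for [j = 2] is even as well. Its weight is -1, so the relation bounds only
   the difference of the terms [j = 0] and [j = 2], by the two odd terms. *)
have diff w : complex.Im w = complex.Im z -> normc (wt a b c d w - wj 2%N w) <= 2 * b0.
  move=> wz; have := rel w wz.
  rewrite !big_ord_recl big_ord0 /= /bump /= mulr0 qc0 mul1r wj0 addr0.
  rewrite -[(1 + 0)%N]/1%N -[(1 + (1 + 0))%N]/2%N -[(1 + (1 + (1 + 0)))%N]/3%N.
  rewrite qc4_half; last by rewrite dvdzE abszN -dvdzE n02.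
  set x1 := qc 4 _ 1; set x3 := qc 4 _ 1 => E.
  have [nx1 nx3] : normc x1 = 1 /\ normc x3 = 1 by split; exact: normc_qc1.
  clearbody x1 x3.
  have -> : wt a b c d w - wj 2%N w = - (x1 * wj 1%N w + x3 * wj 3%N w).
    by apply/eqP; rewrite -subr_eq0 -[X in _ == X]E; apply/eqP; ring.
  rewrite normcN; apply: le_trans (le_normcD _ _) _.
  rewrite (normcM x1) (normcM x3) nx1 nx3 !mul1r.
  by rewrite mulr_natl mulr2n; apply: lerD; exact: wj_bound.
have zM : complex.Im (z + (M%:Z)%:~R) = complex.Im z.
  have -> : (M%:Z)%:~R = (M%:R : R)%:C%C :> R[i] by rewrite -pmulrn rmorph_nat.
  by case: (z) => x y /=; rewrite addr0.
(* The translation by [M] acts on the two remaining cosets by opposite signs. *)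
have shift a' b' : a' * d - b' * c = 1 -> (2 %| a')%Z ->
    wt a' b' c d (z + (M%:Z)%:~R) =
    (kronecker_m4 (1 + M%:Z * (a' * c)))%:~R * wt a' b' c d z.
  move=> D' a'2; rewrite slash_scaled_translate.
  have D'' : a' * (c * M%:Z + d) - (a' * M%:Z + b') * c = 1 by rewrite -D'; ring.
  rewrite (@slash_scaled_proportional R N k f hN f_slash a' b' c d) //.
    have -> : (c * M%:Z + d) * a' - c * b' = 1 + M%:Z * (a' * c) by rewrite -D'; ring.
    by rewrite chi_shift.
  (* An even [a'] makes [a'^2 M] a multiple of [4 M = N]. *)
  have -> : a' * (a' * M%:Z + b') - a' * b' = (a' * a') * M%:Z by ring.
  by rewrite NE PoszM dvdz_mul // -[4%:Z]/(2 * 2 : int) dvdz_mul.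
have M2Z : ~~ (2 %| M%:Z)%Z by rewrite dvdzE.
have [sg sg1 [sa s2]] := kronecker_even_shift M2Z pa pc.
have D2 : (a + 2 * M%:Z * c) * d - (b + 2 * M%:Z * d) * c = 1 by rewrite -D; ring.
have pa2 : (2 %| a + 2 * M%:Z * c)%Z by rewrite rpredD // -mulrA dvdz_mulr.
have := diff _ zM; rewrite (shift _ _ D pa) sa.
have -> : wj 2%N (z + (M%:Z)%:~R) = (- sg)%:~R * wj 2%N z by rewrite /wj shift // s2.
have -> : sg%:~R * wt a b c d z - (- sg)%:~R * wj 2%N z =
  sg%:~R * (wt a b c d z + wj 2%N z) by rewrite intrN; ring.
rewrite normcM normc_int; have -> : `|sg%:~R : R| = 1.
  by case: sg1 => ->; rewrite ?intrN ?normrN normr1.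
rewrite mul1r => plus; have minus := diff z erefl.
(* At [z + M] the bound on the difference becomes one on the sum; together they bound the form by
   [2 b0], and [2 <= N]. *)
have : normc (2 * wt a b c d z) <= 2 * (2 * b0).
  have -> : 2 * wt a b c d z = (wt a b c d z - wj 2%N z) + (wt a b c d z + wj 2%N z).
    by ring.
  apply: le_trans (le_normcD _ _) _; apply: le_trans (lerD minus plus) _.
  by rewrite [leRHS]mulr_natl mulr2n.
rewrite normcM normc_nat ler_pM2l // => le2; apply: le_trans le2 _.
rewrite /= exprS -mulrA -/b0 ler_wpM2r // ler_nat //.
Qed.

End Key.

(** * Coefficient functionals on the plus-minus space *)

Section Growth.
Variable R : realType.
Implicit Types (f : upper_half_plane R -> R[i]).

(** Coefficients measured at height [y0 / 2] keep the denominator of [growth_bound] uniformly away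
    from 0 above [y0]. *)
Lemma growth h f (a : int -> R[i]) (m : int) (y0 : R) : (0 < h)%N ->
  (forall n, n < m -> a n = 0) -> qexpansion h f a -> 0 < y0 ->
  exists2 C : R, 0 <= C & forall t, y0 <= complex.Im (val t) ->
    normc (f t) <= C * expR (- (2 * pi / h%:R * m%:~R * complex.Im (val t))).
Proof.
move=> h0 am fa y00; pose y1 := y0 / 2.
have y10 : 0 < y1 by rewrite divr_gt0.
have y1y0 : 0 < y0 - y1 by rewrite /y1 subr_gt0 ltr_pdivrMr // ltr_pMr // ltr1n.
have [C C0 aC] := coef_bound (Hpt 0 y10) fa; rewrite /= in aC.
set c := 2 * pi / h%:R in aC *.
have c0 : 0 < c by rewrite divr_gt0 ?mulr_gt0 ?pi_gt0 ?ltr0n.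
have r1 := expRN_lt1 h0 y1y0; rewrite -/c in r1.
exists (C * expR (c * m%:~R * y1) / (1 - expR (- (c * (y0 - y1))))).
  by rewrite divr_ge0 ?mulr_ge0 ?expR_ge0 // subr_ge0 ltW.
move=> t y0t; have y1t : y1 < complex.Im (val t) by apply: lt_le_trans y0t; rewrite -subr_gt0.
apply: le_trans (growth_bound h0 am fa C0 aC y1t) _; rewrite -/c.
have -> : - (c * m%:~R * (complex.Im (val t) - y1)) =
  c * m%:~R * y1 + - (c * m%:~R * complex.Im (val t)) by ring.
rewrite expRD mulrA [leRHS]mulrAC ler_wpM2l ?mulr_ge0 ?expR_ge0 //.
rewrite lef_pV2 ?posrE ?subr_gt0 //; last by apply: (expRN_lt1 h0); rewrite subr_gt0.
by rewrite lerB // ler_expR lerN2 ler_wpM2l ?(ltW c0) // lerB.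
Qed.

(** In Cauchy's bound at height [y] the exponentials combine to [exp(- s y)] with [s > 0], and [y]
    can be taken arbitrarily large. *)
Lemma coef_vanish h f (b : int -> R[i]) (n : int) (C u y0 : R) : (0 < h)%N ->
  qexpansion h f b -> 0 <= C ->
  (forall t, y0 <= complex.Im (val t) ->
    normc (f t) <= C * expR (- (2 * pi * u * complex.Im (val t)))) ->
  n%:~R / h%:R < u -> b n = 0.
Proof.
move=> h0 fb C0 fC nu; apply: (normc_eq0_small C0) => e e0.
pose s := 2 * pi * (u - n%:~R / h%:R).
have s0 : 0 < s by rewrite !mulr_gt0 ?pi_gt0 ?subr_gt0.
(* The last entry makes [s y >= 1 / e], hence [exp(- s y) <= e] by [1 + x <= exp x]. *)
pose y := Num.max (Num.max y0 1) (e^-1 / s).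
have y1 : 0 < y by rewrite /y !lt_max ltr01 orbT.
have yy0 : y0 <= y by rewrite /y !le_max lexx.
have ys : e^-1 / s <= y by rewrite /y le_max lexx orbT.
have := @cauchy_bound _ h h0 f b (C * expR (- (2 * pi * u * y))) y fb y1.
move=> /(_ _ n) H; apply: le_trans (H _) _ => [t ty|].
  by apply: le_trans (fC t _) _; rewrite ty.
rewrite -mulrA -expRD ler_wpM2l //.
have -> : - (2 * pi * u * y) + 2 * pi / h%:R * n%:~R * y = - (s * y).
  by rewrite /s; ring.
rewrite expRN -[leRHS]invrK lef_pV2 ?posrE ?invr_gt0 ?expR_gt0 //.
rewrite ler_pdivrMr // mulrC in ys; apply: le_trans ys _.
by apply: le_trans (expR_ge1Dx _); rewrite lerDr.
Qed.

End Growth.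

Section Forms.
Variable R : realType.
Variables (N : nat) (k : int) (eps : nat -> int).
Local Notation H := (upper_half_plane R).
Implicit Types (f g : H -> R[i]).

Lemma weakly_holomorphic_linear psi (c : R[i]) f g :
  weakly_holomorphic_forms N k psi f -> weakly_holomorphic_forms N k psi g ->
  weakly_holomorphic_forms N k psi (c *: f + g).
Proof.
move=> [hf mf qf] [hg mg qg].
have slashE ga : slash k (c *: f + g) ga = c *: slash k f ga + slash k g ga.
  by apply/funext => t; rewrite /slash /= !fctE /= mulrDr; congr (_ + _); exact: mulrCA.
split=> [t|ga Nga|ga].
- have -> : extend0 (c *: f + g) = c *: (extend0 f : R[i]^o -> R[i]^o) + extend0 g.
    apply/funext => z; rewrite -[RHS]/(c * extend0 f z + extend0 g z) /extend0.
    by case: insubP => [u _ _|_] //; rewrite mulr0 addr0.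
  by apply: derivableD => //; apply: derivableZ.
- by rewrite slashE mf // mg // scalerDr !scalerA mulrC.
- have [a fa] := qf ga; have [b gb] := qg ga; rewrite slashE.
  by exists (fun n => c * a n + b n); exact: qexpansion_linear.
Qed.

Lemma qexpansion_zero h : qexpansion h (0 : H -> R[i]) (fun=> 0).
Proof.
apply: (@lim_qexpansion _ _ _ _ 0) => // t e e0; exists 0%N => J _.
by rewrite /psum big1 ?subrr ?normc0 // => i _; rewrite mul0r.
Qed.

Lemma weakly_holomorphic0 psi : weakly_holomorphic_forms N k psi (0 : H -> R[i]).
Proof.
have slash0 ga : slash k (0 : H -> R[i]) ga = 0.
  by apply/funext => t; rewrite /slash /= mulr0.
split=> [t|ga _|ga]; rewrite ?slash0 ?scaler0 //.
  have -> : extend0 (0 : H -> R[i]) = (fun=> 0).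
    by apply/funext => z; rewrite /extend0; case: insubP.
  exact: derivable_cst.
by exists (fun=> 0); exact: qexpansion_zero.
Qed.

Lemma Aeps_linear (c : R[i]) f g : Aeps N k eps f -> Aeps N k eps g ->
  Aeps N k eps (c *: f + g).
Proof.
move=> [wf [a [fa ae]]] [wg [b [gb be]]]; split; first exact: weakly_holomorphic_linear.
exists (fun n => c * a n + b n); split; first exact: qexpansion_linear.
by move=> n p pN np; rewrite (ae n p) // (be n p) // mulr0 addr0.
Qed.

Lemma Aeps0 : Aeps N k eps (0 : H -> R[i]).
Proof.
by split; [exact: weakly_holomorphic0 | exists (fun=> 0); split=> //; exact: qexpansion_zero].
Qed.

Definition qcoef f : int -> R[i] := xget (fun=> 0) [set a | qexpansion 1 f a].

Lemma qcoefE f a : qexpansion 1 f a -> qcoef f = a.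
Proof.
move=> fa; rewrite /qcoef; case: xgetP => [b _ fb|/(_ a) //].
exact: (qexpansion_inj (isT : (0 < 1)%N) fb fa).
Qed.

Lemma qcoefP f : Aeps N k eps f -> qexpansion 1 f (qcoef f).
Proof. by move=> [_ [a [fa _]]]; rewrite (qcoefE fa). Qed.

Lemma qcoef_linear (c : R[i]) f g n : Aeps N k eps f -> Aeps N k eps g ->
  qcoef (c *: f + g) n = c * qcoef f n + qcoef g n.
Proof.
move=> /qcoefP fa /qcoefP gb.
by rewrite (qcoefE (qexpansion_linear c fa gb)).
Qed.

(** The definitions ask for an expansion anew in each clause; by uniqueness all of them are
    [qcoef f]. *)
Lemma Aeps_fromE m : @Aeps_from R N k eps m = order_ge (Aeps N k eps) qcoef m.
Proof.
apply/seteqP; split=> f [fA].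
  by move=> [a [fa am]]; split=> // n; rewrite (qcoefE fa); exact: am.
by move=> am; split=> //; exists (qcoef f); split=> //; exact: qcoefP.
Qed.

Lemma leading_termE f c n : Aeps N k eps f -> leading_term f c n <-> leads qcoef f c n.
Proof.
move=> fA; split=> [[a [fa an ac]]|[an ac]].
  by split=> [i|]; rewrite (qcoefE fa) //; exact: an.
by exists (qcoef f); split=> //; exact: qcoefP.
Qed.

Lemma is_orderE n : is_order (Aeps N k eps) qcoef n <->
  exists g, @Aeps R N k eps g /\ leading_term g 1 n.
Proof.
by split=> -[g [gA gl]]; exists g; split=> //; move: gl; rewrite leading_termE.
Qed.

Lemma reducedE n f : reduced N k eps n f <->
  red (Aeps N k eps) qcoef (fun n => (s_mult N n)%:R^-1) n f.
Proof.
split=> [[fA /(leading_termE _ _ fA) fl [a [fa ha]]]|[fA fl ha]]; split=> //.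
- by move=> i ni; rewrite (qcoefE fa) => ai /is_orderE; exact: ha.
- exact/leading_termE.
- exists (qcoef f); split; first exact: qcoefP.
  by move=> i ni ai /is_orderE; exact: ha.
Qed.

End Forms.

(** * Cusps and orders of vanishing *)

Section Cusps.
Variable R : realType.
Variables (N : nat) (k : int) (eps : nat -> int).
Hypothesis hN : (1 < N)%N.
Hypothesis hodd : squarefree (N`_2^')%N.
Hypothesis h2 : (N`_2 = 1 \/ N`_2 = 4)%N.
Hypothesis heps : forall p : nat, p \in primes N -> eps p = 1 \/ eps p = -1.
Local Notation H := (upper_half_plane R).
Implicit Types (f g : H -> R[i]).
Local Notation K := (N%:R ^+ size (primes N) : R).

Let N0 : (0 : R) < N%:R. Proof. by rewrite ltr0n ltnW. Qed.
Let NX : (0 < N)%N. Proof. exact: ltnW. Qed.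
Let K0 : 0 <= K. Proof. by rewrite exprn_ge0 // ltW. Qed.

Lemma slash_scaled_le f a b c d z (B : R) : Aeps N k eps f ->
  a * d - b * c = 1 -> 0 < complex.Im z ->
  (forall w, complex.Im w = complex.Im z -> normc (extend0 f (w / N%:R)) <= B) ->
  normc (slash_scaled N k f a b c d z) <= K * B.
Proof. by move=> fA D z0 fB; apply: (slash_scaled_bound hN hodd h2 heps fA). Qed.

Lemma extend0_pt f w (B : R) : 0 < complex.Im w ->
  (forall t : H, complex.Im (val t) = complex.Im w / N%:R -> normc (f t) <= B) ->
  normc (extend0 f (w / N%:R)) <= B.
Proof.
move=> w0 fB; have w0' : 0 < complex.Im (w / N%:R) by rewrite Im_divN divr_gt0.
pose t : H := exist (fun z : R[i] => 0 < complex.Im z) _ w0'.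
by rewrite -[w / _]/(val t) extend0_val; apply: fB; rewrite /= Im_divN.
Qed.

(* [diag(N, 1) g = g' (al, be; 0, de)] with [g'] in SL2(Z) and [al de = N]. *)
Lemma slash_upper_triangular f (g : SL2Z) (t : H) : Aeps N k eps f ->
  exists (a b c d be : int) (al de : nat),
  [/\ a * d - b * c = 1, (al * de = N)%N &
   slash k f g t = (de%:R : R[i]) ^ (- k) *
     slash_scaled N k f a b c d ((al%:R * val t + be%:~R) / de%:R)].
Proof.
move=> fA; have := sl2E g; set A := mx g 0 0; set B := mx g 0 1.
set C := mx g 1 0; set D := mx g 1 1 => ABCD.
(* The first column of diag(N, 1) g is [(N A, C)]; dividing it by its gcd and completing by Bezout
   gives [g']. *)
pose al := gcdn `|(N%:Z * A)%R| `|C|.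
have alNA : (al%:Z %| N%:Z * A)%Z by rewrite dvdzE /= dvdn_gcdl.
have alC : (al%:Z %| C)%Z by rewrite dvdzE /= dvdn_gcdr.
have alN : (al %| N)%N.
  have : (al%:Z %| N%:Z)%Z.
    have -> : N%:Z = N%:Z * A * D - N%:Z * B * C.
      by rewrite -[LHS]mulr1 -[X in _ * X]ABCD; ring.
    by apply: rpredB; [exact: dvdz_mulr | exact: dvdz_mull].
  by rewrite dvdzE.
have alde : (al * (N %/ al) = N)%N by rewrite mulnC divnK.
move: (N %/ al)%N alde => de alde.
have /andP[al0 de0] : (0 < al)%N && (0 < de)%N by rewrite -muln_gt0 alde.
have [a aE] := dvdzP alNA; have [c cE] := dvdzP alC.
have [u [v uv]] : exists u v, u * (N%:Z * A) + v * C = al%:Z.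
  by have [u [v uv]] := Bezoutz (N%:Z * A) C; exists u, v; rewrite uv.
have alZ : al%:Z != 0 by rewrite eqz_nat -lt0n.
have NZ : N%:Z = al%:Z * de%:Z by rewrite -PoszM alde.
have det1 : a * u - (- v) * c = 1.
  by apply: (mulIf alZ); rewrite mul1r -[RHS]uv aE cE; ring.
have deE : de%:Z = a * D - c * (N%:Z * B).
  apply: (mulfI alZ); rewrite -NZ -[LHS]mulr1 -[X in _ * X]ABCD.
  have -> : al%:Z * (a * D - c * (N%:Z * B)) = a * al%:Z * D - c * al%:Z * (N%:Z * B) by ring.
  by rewrite -aE -cE; ring.
(* The upper right entry of [g'^(-1)] diag(N, 1) [g]. *)
pose be := u * (N%:Z * B) + v * D.
exists a, (- v), c, u, be, al, de; split=> //.
set z := val t.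
have z0 : 0 < complex.Im z by exact: (valP t).
have Cz := denom_neq0 ABCD z0.
have toC (x y : int) : x = y -> x%:~R = y%:~R :> R[i] by move->.
have deC : (de%:R : R[i]) != 0 by rewrite pnatr_eq0 -lt0n.
have NC : (N%:R : R[i]) != 0 by rewrite pnatr_eq0 -lt0n.
have num : a%:~R * ((al%:R * z + be%:~R) / de%:R) + (- v)%:~R =
    N%:R * (A%:~R * z + B%:~R) / de%:R :> R[i].
  have e1 : a * be + (- v) * de%:Z = N%:Z * B.
    rewrite -[RHS]mulr1 -[X in _ = _ * X]det1 deE /be; ring.
  apply: (mulIf deC); rewrite divfK // mulrDl mulrA divfK // mulrDr mulrDr -addrA.
  have -> : a%:~R * (al%:R * z) = N%:R * (A%:~R * z) :> R[i].
    by rewrite !mulrA; congr (_ * z); have := toC _ _ aE; rewrite !intrM -!pmulrn.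
  by congr (_ + _); have := toC _ _ e1; rewrite intrD !intrM -!pmulrn.
have den : c%:~R * ((al%:R * z + be%:~R) / de%:R) + u%:~R =
    (C%:~R * z + D%:~R) / de%:R :> R[i].
  have e1 : c * be + u * de%:Z = D.
    rewrite -[RHS]mulr1 -[X in _ = _ * X]det1 deE /be; ring.
  apply: (mulIf deC); rewrite divfK // mulrDl mulrA divfK // mulrDr -addrA.
  have -> : c%:~R * (al%:R * z) = C%:~R * z :> R[i].
    by rewrite !mulrA; congr (_ * z); have := toC _ _ cE; rewrite !intrM -!pmulrn.
  by congr (_ + _); have := toC _ _ e1; rewrite intrD !intrM -!pmulrn.
rewrite /slash_scaled /moeb num den mulrA -expfzMl.
have -> : N%:R * (A%:~R * z + B%:~R) / de%:R / ((C%:~R * z + D%:~R) / de%:R) / N%:R =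
    moeb A B C D z by rewrite /moeb; field; rewrite NC deC Cz.
have -> : de%:R * ((C%:~R * z + D%:~R) / de%:R) = C%:~R * z + D%:~R by field.
by rewrite /slash; congr (_ * _); rewrite -(extend0_val f (moebius g t)).
Qed.

(** The triangular decomposition replaces [t] by a point [U] with [Im U >= Im t / N], and the
    scaling in [slash_scaled] costs another [N]. So [f|g] decays at rate [m / N^2], against [n / N]
    for its term of index [n]. *)
Lemma slash_growth f (a : int -> R[i]) (m : int) (g : SL2Z) (b : int -> R[i]) :
  Aeps N k eps f -> qexpansion 1 f a -> (forall n, n < m -> a n = 0) -> 0 <= m ->
  qexpansion N (slash k f g) b -> forall n : int, n * N%:Z < m -> b n = 0.
Proof.
move=> fA fa am m0 gb n nm.
have iN0 : 0 < (N%:R^-1 : R) by rewrite invr_gt0.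
have [C C0 fC] := growth (isT : (0 < 1)%N) am fa iN0.
rewrite divr1 in fC.
pose u : R := m%:~R / N%:R ^+ 2.
have m0R : 0 <= m%:~R :> R by rewrite ler0z.
have pi2 : 0 <= 2 * pi :> R by rewrite mulr_ge0 ?pi_ge0.
have bnd (de : nat) : (0 < de)%N -> 0 <= (de%:R : R) ^ (- k) by move=> ?; rewrite exprz_ge0.
(* The divisor [de] may vary with [t], so the constant sums over all candidates. *)
pose C' := (1 + \sum_(de < N.+1) (de%:R : R) ^ (- k)) * (K * C).
have S0 : 0 <= \sum_(de < N.+1) (de%:R : R) ^ (- k).
  by apply: sumr_ge0 => i _; rewrite exprz_ge0.
have C'0 : 0 <= C' by rewrite !mulr_ge0 ?addr_ge0.
apply: (@coef_vanish _ N _ _ _ C' u N%:R NX gb C'0); last first.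
  rewrite /u ltr_pdivrMr // -mulrA expr2 invfM -mulrA mulVf ?mulr1 ?gt_eqF //.
  by rewrite ltr_pdivlMr // -[N%:R]/((N%:Z)%:~R) -intrM ltr_int.
move=> t Nt; have t0 : 0 < complex.Im (val t) by exact: (valP t).
have [a1 [b1 [c1 [d1 [be [al [de [D alde ->]]]]]]]] := slash_upper_triangular g t fA.
have /andP[al0 de0] : (0 < al)%N && (0 < de)%N by rewrite -muln_gt0 alde.
have deN : (de <= N)%N by rewrite -alde leq_pmull.
set U := (_ + _) / _.
have de0R : 0 < de%:R :> R by rewrite ltr0n.
have UE : complex.Im U = al%:R * complex.Im (val t) / de%:R.
  rewrite /U Im_divN; congr (_ / _).
  have -> : be%:~R = (be%:~R : R)%:C%C :> R[i] by rewrite rmorph_int.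
  have -> : al%:R = (al%:R : R)%:C%C :> R[i] by rewrite rmorph_nat.
  by case: (val t) => x y /=; rewrite addr0 mul0r addr0.
have UN : complex.Im (val t) / N%:R <= complex.Im U.
  rewrite UE ler_pM ?invr_ge0 ?(ltW t0) ?(ltW N0) //.
    by rewrite ler_peMl ?ler1n // ltW.
  by rewrite lef_pV2 ?posrE // ler_nat.
have U1 : 1 <= complex.Im U by apply: le_trans UN; rewrite ler_pdivlMr // mul1r.
have U0 : 0 < complex.Im U by apply: lt_le_trans U1.
rewrite normcM normc_exprz normc_nat.
have W : normc (slash_scaled N k f a1 b1 c1 d1 U) <=
    K * (C * expR (- (2 * pi * u * complex.Im (val t)))).
  apply: slash_scaled_le => // w wU; apply: extend0_pt => [|t' t'E]; first by rewrite wU.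
  have t'N : N%:R^-1 <= complex.Im (val t').
    by rewrite t'E wU ler_peMl // ltW.
  apply: le_trans (fC t' t'N) _; rewrite ler_wpM2l // ler_expR lerN2.
  suff uy : u * complex.Im (val t) <= m%:~R * complex.Im (val t').
    by have := ler_wpM2l pi2 uy; rewrite !mulrA.
  have -> : u * complex.Im (val t) = m%:~R * (complex.Im (val t) / N%:R / N%:R).
    by rewrite /u; field; rewrite gt_eqF.
  by rewrite ler_wpM2l // t'E wU ler_wpM2r // ltW.
have dS : (de%:R : R) ^ (- k) <= 1 + \sum_(de < N.+1) (de%:R : R) ^ (- k).
  rewrite ler_wpDl // (bigD1 (Ordinal (deN : (de < N.+1)%N))) //= lerDl.
  by apply: sumr_ge0 => i _; rewrite exprz_ge0.
rewrite /C' -(mulrA (1 + _)) -(mulrA K).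
by apply: ler_pM; rewrite ?exprz_ge0 ?normc_ge0.
Qed.

Lemma slash1 f (g : SL2Z) : mx g = 1%:M -> slash k f g = f.
Proof.
move=> g1; apply/funext => t; rewrite /slash -(extend0_val f (moebius g t)) /=.
rewrite /moebius_fun /denom g1 !mxE /= mul0r add0r mul1r addr0 divr1 exp1rz mul1r.
exact: extend0_val.
Qed.

(** At [g = 1] the expansion in powers of [q_N] forces decay at rate [m / N], which rules out powers
    of [q] of smaller exponent. *)
Lemma expansion_at_infinity f (a : int -> R[i]) (m : int) : qexpansion 1 f a ->
  (forall g : SL2Z, exists b, qexpansion N (slash k f g) b /\
     forall n, n < m -> b n = 0) ->
  forall n : int, n * N%:Z < m -> a n = 0.
Proof.
move=> fa fg n nm.
have D : 1 * 1 - 0 * 0 = 1 :> int by [].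
have [b [fb bm]] := fg (sl2 D).
rewrite slash1 in fb; last first.
  apply/matrixP => i j; rewrite !mxE.
  by case: i => [[|[|i]] // Hi]; case: j => [[|[|j]] // Hj].
have [C C0 fC] := growth NX bm fb ltr01.
apply: (@coef_vanish _ 1 _ _ _ C (m%:~R / N%:R) 1 isT fa C0) => [t t1|].
  by have := fC t t1; rewrite -!mulrA (mulrCA N%:R^-1) !mulrA.
rewrite divr1 ltr_pdivlMr // -[N%:R]/((N%:Z)%:~R) -intrM ltr_int //.
Qed.

(** In both comparison lemmas the threshold [n N < m] means [n < 0] at [m = 0], and [n <= 0] at
    [m = 1] for cusp forms, so passing between [q] and [q_N] loses nothing. *)
Lemma MepsE : Meps N k eps = @Aeps_from R N k eps 0.
Proof.
apply/seteqP; split=> f.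
  move=> [[wf fg] fA]; split=> //; have [_ [a [fa ae]]] := fA.
  exists a; split=> // n n0; apply: (expansion_at_infinity fa fg).
  by rewrite pmulr_llt0 // ltz_nat.
move=> [fA [a [fa a0]]]; have [wf _] := fA; split=> //; split=> // g.
have [_ _ /(_ g)[b gb]] := wf; exists b; split=> // n n0.
by apply: (slash_growth fA fa a0 (lexx _) gb); rewrite pmulr_llt0 // ltz_nat.
Qed.

Lemma SepsE : Seps N k eps = @Aeps_from R N k eps 1.
Proof.
apply/seteqP; split=> f.
  move=> [[wf fg] fA]; split=> //; have [_ [a [fa ae]]] := fA.
  exists a; split=> // n n1.
  have fg1 (g : SL2Z) : exists b, qexpansion N (slash k f g) b /\ forall n, n < 1 -> b n = 0.
    by have [b [gb b0]] := fg g; exists b; split=> // i i1; apply: b0; rewrite -ltzD1 add0r.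
  have n0 : n <= 0 by rewrite -ltzD1 add0r.
  apply: (expansion_at_infinity fa fg1).
  by apply: (@le_lt_trans _ _ 0) => //; rewrite pmulr_lle0 // ltz_nat.
move=> [fA [a [fa a0]]]; have [wf _] := fA; split=> //; split=> // g.
have [_ _ /(_ g)[b gb]] := wf; exists b; split=> // n n0.
apply: (slash_growth fA fa a0 ler01 gb).
by apply: (@le_lt_trans _ _ 0) => //; rewrite pmulr_lle0 // ltz_nat.
Qed.

(* Siegel's argument: a bound on the line [Im z = 1 / 2] gives Fourier
   coefficient bounds, hence exponentially small values on [Im z >= 1], which
   contains the image of the strip's bottom under [z |-> - 1 / z]. *)
Lemma line_bound_halves : exists m : nat, forall f (a : int -> R[i]) (B : R),
  Aeps N k eps f -> qexpansion 1 f a -> (forall n, n < m%:Z -> a n = 0) -> 0 <= B ->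
  (forall t : H, complex.Im (val t) = (N%:R *+ 2)^-1 -> normc (f t) <= B) ->
  forall t : H, complex.Im (val t) = (N%:R *+ 2)^-1 -> normc (f t) <= B / 2.
Proof.
pose y1 : R := (N%:R *+ 2)^-1.
have y10 : 0 < y1 by rewrite invr_gt0 pmulrn_lgt0.
have iN0 : 0 < (N%:R^-1 : R) by rewrite invr_gt0.
pose c : R := 2 * pi / 1%:R.
have c0 : 0 < c by rewrite divr_gt0 ?mulr_gt0 ?pi_gt0.
pose r := expR (- (c * y1)).
have r01 : 0 <= r < 1 by rewrite expR_ge0 (expRN_lt1 (isT : (0 < 1)%N)).
have [r0 r1] := andP r01.
have r10 : 0 < 1 - r by rewrite subr_gt0.
have half0 : 0 < 2^-1 :> R by rewrite invr_gt0.
(* The three factors bound [|z|^k], the passage to another coset and the geometric series; a large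
   power [r ^+ m] brings the product down to 1/2. *)
have [m _ mE] := exprn_small (2 ^+ `|k| * K / (1 - r)) 0 r01 half0.
exists m => f a B fA fa am B0 fB t ty.
have aB n : normc (a n) <= B * expR (c * n%:~R * y1).
  exact: (cauchy_bound (isT : (0 < 1)%N) fa y10 fB).
have high (t' : H) : N%:R^-1 <= complex.Im (val t') ->
    normc (f t') <= B * r ^+ m / (1 - r).
  move=> Nt'; have y1t : y1 <= complex.Im (val t') - y1.
    rewrite lerBrDl; apply: le_trans Nt'.
    by have -> : y1 + y1 = N%:R^-1 by rewrite /y1 -mulr_natl; field; rewrite gt_eqF.
  have y1t' : y1 < complex.Im (val t') by rewrite -subr_gt0 (lt_le_trans y10).
  apply: le_trans (growth_bound (isT : (0 < 1)%N) am fa B0 aB y1t') _; rewrite -/c.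
  apply: ler_pM; rewrite ?invr_ge0 ?mulr_ge0 ?expR_ge0 //.
  - by rewrite subr_ge0 ltW // (expRN_lt1 (isT : (0 < 1)%N)) // (lt_le_trans y10).
  - rewrite ler_wpM2l // /r -expRM_natl ler_expR mulrN lerN2 -pmulrn.
    rewrite mulrCA mulrA ler_wpM2l // mulr_ge0 ?ler0n ?ltW //.
  - rewrite lef_pV2 ?posrE //.
      by rewrite lerB // ler_expR lerN2 ler_wpM2l // ltW.
    by rewrite subr_gt0 (expRN_lt1 (isT : (0 < 1)%N)) // (lt_le_trans y10).
set B' := B * r ^+ m / (1 - r) in high.
have B'0 : 0 <= B' by rewrite /B' divr_ge0 ?mulr_ge0 ?exprn_ge0 // ltW.
(* [n] is an integer nearest to the real part [x] of [N t], so [x' + i / 2] lies on the bottom of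
   the strip. *)
pose x := complex.Re (val t) * N%:R; pose n := Num.floor (x + 2^-1).
pose x' := x - n%:~R.
have [x'l x'u] : - 2^-1 <= x' /\ x' <= 2^-1.
  have := floor_itv (x + 2^-1); rewrite -/n intrD /x' => /andP[].
  by move=> l1 l2; split; lra.
have x'2 : x' ^+ 2 <= 1 / 4.
  have : 0 <= (2^-1 - x') * (2^-1 + x') by apply: mulr_ge0; lra.
  by rewrite expr2; lra.
pose q := x' ^+ 2 + 1 / 4.
have [q1 q2] : 1 / 4 <= q /\ q <= 1 / 2.
  by split; rewrite /q; have := sqr_ge0 x'; lra.
have q0 : 0 < q by lra.
have qn0 : q != 0 by rewrite gt_eqF.
(* This is [-1 / (x' + i / 2)], with [q] the squared norm of the denominator; [q <= 1 / 2] gives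
   [Im z >= 1]. *)
pose z : R[i] := (- x' / q +i* (1 / 2 / q))%C.
have z1 : 1 <= complex.Im z by rewrite /z /= ler_pdivlMr //; lra.
have z0 : 0 < complex.Im z by apply: lt_le_trans z1.
have zN : z != 0 by apply/negP => /eqP zE; move: z0; rewrite zE ltxx.
have d1 : 1%:~R * z + 0%:~R = z by rewrite mul1r addr0.
have norm_z : normc z ^+ 2 = q^-1.
  rewrite /normc /= sqr_sqrtr ?addr_ge0 ?sqr_ge0 //.
  rewrite !(expr_div_n _ q) -mulrDl sqrrN.
  have -> : x' ^+ 2 + (1 / 2) ^+ 2 = q by rewrite /q; field.
  by field; exact: qn0.
have tz : moeb n (-1) 1 0 z / N%:R = val t.
  have zu : z * (x' +i* (1 / 2))%C = -1.
    apply/eqP; rewrite eq_complex /=; apply/andP; split; apply/eqP.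
      have -> : - x' / q * x' - 1 / 2 / q * (1 / 2) = - ((x' ^+ 2 + 1 / 4) / q).
        by field; exact: qn0.
      by rewrite -/q divff.
    by field; exact: qn0.
  have -> : moeb n (-1) 1 0 z = n%:~R + (x' +i* (1 / 2))%C.
    rewrite /moeb d1; apply: (mulIf zN); rewrite divfK // mulrDl.
    by congr (_ + _); rewrite mulrC zu.
  have -> : n%:~R = (n%:~R : R)%:C%C :> R[i] by rewrite rmorph_int.
  have -> : (N%:R : R[i])^-1 = (N%:R^-1 : R)%:C%C by rewrite fmorphV rmorph_nat.
  apply/eqP; rewrite eq_complex /= ty; apply/andP; split; apply/eqP.
    by rewrite /x' /x; field; rewrite gt_eqF.
  by rewrite -[N%:R *+ 2]mulr_natl; field; rewrite gt_eqF.
have D : n * 0 - (-1) * 1 = 1 by rewrite mulr0 sub0r mulr1 opprK.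
have W : normc (slash_scaled N k f n (-1) 1 0 z) <= K * B'.
  apply: slash_scaled_le => // w wz; apply: extend0_pt => [|t' t'E]; first by rewrite wz.
  by apply: high; rewrite t'E wz ler_peMl // ltW.
have fW : f t = z ^ k * slash_scaled N k f n (-1) 1 0 z.
  by rewrite /slash_scaled tz extend0_val d1 mulrA -expfzDr // subrr expr0z mul1r.
(* From [|z|^2 = 1 / q] and [1 / 4 <= q <= 1 / 2] it follows that [1 <= |z| <= 2]. *)
have nz : normc z ^ k <= 2 ^+ `|k|.
  have nz1 : 1 <= normc z ^+ 2 by rewrite norm_z invf_ge1 //; lra.
  have nz2 : normc z ^+ 2 <= 2 ^+ 2 by rewrite norm_z invf_ple ?posrE //; lra.
  have {}nz1 : 1 <= normc z by rewrite -(ler_pXn2r (n := 2)) ?nnegrE ?normc_ge0 ?expr1n.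
  have {}nz2 : normc z <= 2 by rewrite -(ler_pXn2r (n := 2)) ?nnegrE ?normc_ge0.
  case: (k) => j; first by rewrite -exprnP lerXn2r ?nnegrE ?normc_ge0.
  apply: (@le_trans _ _ 1); last by rewrite exprn_ege1 // ler1n.
  by rewrite NegzE -exprnN invf_le1 ?exprn_ege1 // exprn_gt0 // (lt_le_trans ltr01).
rewrite fW normcM normc_exprz.
apply: le_trans (ler_pM _ _ nz W) _; rewrite ?exprz_ge0 ?normc_ge0 //.
have -> : 2 ^+ `|k| * (K * B') = 2 ^+ `|k| * K / (1 - r) * r ^+ m * B.
  by rewrite /B'; ring.
by rewrite [leRHS]mulrC ler_wpM2r.
Qed.

(** Growth gives some bound on the line; repeated halving drives it to 0, and Cauchy's bound then
    makes all coefficients vanish. *)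
Lemma Aeps_order_bound : exists m : nat, forall f (a : int -> R[i]),
  Aeps N k eps f -> qexpansion 1 f a -> (forall n, n < m%:Z -> a n = 0) -> f = 0.
Proof.
have [m half] := line_bound_halves; exists m => f a fA fa am.
have y1 : 0 < (N%:R *+ 2)^-1 :> R by rewrite invr_gt0 pmulrn_lgt0.
have [C C0 fC] := growth (isT : (0 < 1)%N) am fa y1.
have [B B0 fB] : exists2 B : R, 0 <= B &
    forall t : H, complex.Im (val t) = (N%:R *+ 2)^-1 -> normc (f t) <= B.
  exists (C * expR (- (2 * pi / 1%:R * (m%:Z)%:~R * (N%:R *+ 2)^-1))).
    by rewrite mulr_ge0 ?expR_ge0.
  by move=> t tE; have := fC t; rewrite tE; apply.
have fBi i : forall t : H, complex.Im (val t) = (N%:R *+ 2)^-1 ->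
    normc (f t) <= B * 2^-1 ^+ i.
  elim: i => [|i IH]; first by rewrite expr0 mulr1.
  rewrite exprSr mulrA; apply: (half f a) => //.
  by rewrite mulr_ge0 ?exprn_ge0 // invr_ge0.
have a0 n : a n = 0.
  apply: (@normc_eq0_small _ _ (expR (2 * pi / 1%:R * n%:~R * (N%:R *+ 2)^-1))).
    exact: expR_ge0.
  move=> e e0; have h01 : 0 <= (2^-1 : R) < 1 by apply/andP; split; lra.
  have [i _ Be] := exprn_small B 0 h01 e0.
  apply: le_trans (cauchy_bound (isT : (0 < 1)%N) fa y1 (fBi i) n) _.
  by rewrite mulrC ler_wpM2l ?expR_ge0.
by apply/funext => t; exact: (qexpansion0 fa a0).
Qed.

End Cusps.

(** * Canonical bases of reduced forms *)

Theorem proposition5p3 (R : realType) (N : nat) (k : int) (eps : nat -> int)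
    (hN : (1 < N)%N) (hodd : squarefree (N`_2^')%N)
    (h2 : (N`_2 = 1 \/ N`_2 = 4)%N)
    (hk : chi N (-1) = (-1) ^ k)
    (heps : forall p : nat, p \in primes N -> eps p = 1 \/ eps p = -1) :
  [/\ forall m : int,
        is_basis [set f | exists n : int, m <= n /\ reduced N k eps n f]
                 (@Aeps_from R N k eps m),
      is_basis [set f | exists n : int, reduced N k eps n f]
               (@Aeps R N k eps),
      is_basis [set f | (exists n : int, reduced N k eps n f) /\
                        Meps N k eps f]
               (@Meps R N k eps) &
      is_basis [set f | (exists n : int, reduced N k eps n f) /\
                        Seps N k eps f]
               (@Seps R N k eps)].
Proof.
have [top topP] := @Aeps_order_bound R N k eps hN hodd h2 heps.
have co_lb (u : upper_half_plane R -> R[i]) : Aeps N k eps u ->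
    exists m, forall n, n < m -> qcoef u n = 0.
  by move=> /qcoefP[m [um _]]; exists m.
have co_top (u : upper_half_plane R -> R[i]) : Aeps N k eps u ->
    (forall n, n < top%:Z -> qcoef u n = 0) -> u = 0.
  by move=> uA; exact: topP uA (qcoefP uA).
have s_neq0 n : ((s_mult N n)%:R^-1 : R[i]) != 0.
  by rewrite invr_eq0 pnatr_eq0 -lt0n expn_gt0.
have A0 := @Aeps0 R N k eps.
have AD c u v := @Aeps_linear R N k eps c u v.
have cD c u v n := @qcoef_linear R N k eps c u v n.
have basis_ge m := red_basis_ge A0 AD cD co_lb co_top s_neq0 m.
have redE m : [set u : upper_half_plane R -> R[i] | exists n, m <= n /\
      red (Aeps N k eps) (@qcoef R) (fun n => (s_mult N n)%:R^-1) n u] =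
    [set f | exists n : int, m <= n /\ reduced N k eps n f].
  by apply/seteqP; split=> f [n [mn /reducedE rn]]; exists n.
have basis_from m : is_basis [set f | exists n : int, m <= n /\ reduced N k eps n f]
    (@Aeps_from R N k eps m) by rewrite Aeps_fromE -redE.
(* A nonzero leading coefficient keeps a reduced form of order less than [m] out of the filtration
   step [m]; holomorphic and cusp forms are the steps 0 and 1. *)
have meetE (m : int) : [set f : upper_half_plane R -> R[i] |
      (exists n : int, reduced N k eps n f) /\ Aeps_from N k eps m f] =
    [set f | exists n : int, m <= n /\ reduced N k eps n f].
  rewrite Aeps_fromE; apply/seteqP; split=> f.
    move=> [[n rn] [_ fm]]; exists n; split=> //; rewrite leNgt; apply/negP => nm.
    have [_ [_ sn] _] := (reducedE N k eps n f).1 rn.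
    by have := s_neq0 n; rewrite -sn fm // eqxx.
  move=> [n [mn rn]]; split; first by exists n.
  have [fA [f0 _] _] := (reducedE N k eps n f).1 rn.
  by split=> // i im; apply: f0; exact: lt_le_trans mn.
split=> //.
- have -> : [set f | exists n : int, @reduced R N k eps n f] =
    [set u | exists n, red (Aeps N k eps) (@qcoef R) (fun n => (s_mult N n)%:R^-1) n u].
    by apply/seteqP; split=> f [n /reducedE rn]; exists n.
  exact: red_basis A0 AD cD co_lb co_top s_neq0.
- by rewrite (@MepsE R N k eps hN hodd h2 heps) meetE.
- by rewrite (@SepsE R N k eps hN hodd h2 heps) meetE.
Qed.
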